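(* Let $H$ be a separable infinite-dimensional complex Hilbert space and let $T\in B(H)$ be an operator which is not of the form $T=\lambda I+K$ for some $\lambda\in\mathbb C$ and a compact operator $K\in B(H)$. Then there exists $\delta>0$ (depending only on the diameter of $W_e(T)$) with the following property: if $B\subset\mathbb N\times\mathbb N$ is subdiagonal and admissible, and $\{a_{nj}:(n,j)\in B\}\subset\mathbb C$ satisfies $$\sum_{n:(n,j)\in B}|a_{nj}|\le\delta\ \text{ for all }j\in\mathbb N\qquad\text{and}\qquad\sum_{j:(n,j)\in B}|a_{nj}|\le\delta\ \text{ for all }n\in\mathbb N,$$ then there is an orthonormal basis $(u_n)_{n=1}^\infty$ of $H$ such that $$\langle Tu_j,u_n\rangle=a_{nj}$$ for all $n,j\in\mathbb N$ with $(n,j)\in B$.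
   Context: $B(H)$ is the space of bounded linear operators on $H$; $\mathbb N=\{1,2,\dots\}$. The essential numerical range $W_e(T)$ is the set of all $\lambda\in\mathbb C$ for which there exists an orthonormal sequence $(x_n)_{n=1}^\infty\subset H$ with $\lim_{n\to\infty}\langle Tx_n,x_n\rangle=\lambda$. A set $B\subset\mathbb N\times\mathbb N$ is subdiagonal if $B\subset\{(n,j)\in\mathbb N\times\mathbb N:n>j\}$. A set $B\subset(\mathbb N\times\mathbb N)\setminus\{(n,n):n\in\mathbb N\}$ is admissible if for every $m\in\mathbb N$ there exists $n\in\mathbb N$, $n>m$, such that $(j,n)\notin B$ and $(n,j)\notin B$ for all $j=1,\dots,m$. *)

(* Defs.v *)
From HB Require Import structures.
From mathcomp Require Export all_boot all_order all_algebra.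
From mathcomp Require Export complex.
From mathcomp Require Export all_classical all_reals all_analysis.

Set Implicit Arguments.
Unset Strict Implicit.
Unset Printing Implicit Defensive.

Import Order.TTheory GRing.Theory Num.Theory.
Import numFieldNormedType.Exports.

Local Open Scope classical_set_scope.
Local Open Scope ring_scope.
Local Open Scope complex_scope.

(* The modulus of a complex number as an element of [R]; the norm [`|z|] of
   [z : R[i]] has values in [R[i]]. *)
Notation modulus := (@Normc.normc _).

(* [sup] is the usual supremum only for bounded nonempty sets, such as the
   essential numerical range of a bounded operator in infinite dimension. *)
Definition diameter (R : realType) (A : set R[i]) : R :=
  sup [set r | exists z w, [/\ A z, A w & r = modulus (z - w)]].

Section HilbertSpace.
Variables (R : realType) (H : completeNormedModType R[i]).

Definition separable_space : Prop :=
  exists2 D : set H, countable D & dense D.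

Definition infinite_dimensional : Prop :=
  ~ exists (n : nat) (e : 'I_n -> H),
      forall x, exists c : 'I_n -> R[i], x = \sum_(i < n) c i *: e i.

Definition bounded_operator (T : {linear H -> H}) : Prop :=
  bounded_near T (nbhs (0 : H)).

Definition compact_operator (K : {linear H -> H}) : Prop :=
  precompact (K @` [set x | `|x| <= 1]).

Definition scalar_plus_compact (T : {linear H -> H}) : Prop :=
  exists (lambda : R[i]) (K : {linear H -> H}),
    [/\ bounded_operator K, compact_operator K
      & forall x, T x = lambda *: x + K x].

(* The inner product, linear in its first argument.  A Hilbert space is a
   complete normed space whose norm is induced by such a form. *)
Variable ip : {dot H for @Num.conj R[i]}.

Definition induces_norm : Prop := forall x : H, ip x x = `|x| ^+ 2.

Definition orthonormal_sequence (u : nat -> H) : Prop :=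
  forall i j, ip (u i) (u j) = (i == j)%:R.

Definition linear_span (u : nat -> H) : set H :=
  [set x | exists n (c : nat -> R[i]), x = \sum_(i < n) c i *: u i].

Definition orthonormal_basis (u : nat -> H) : Prop :=
  orthonormal_sequence u /\ dense (linear_span u).

Definition essential_numerical_range (T : {linear H -> H}) : set R[i] :=
  [set lambda | exists2 x : nat -> H, orthonormal_sequence x &
     (fun n => ip (T (x n)) (x n) : R[i]^o) @ \oo --> (lambda : R[i]^o)].

End HilbertSpace.

(* Indices range over [nat] instead of {1, 2, ...}: the pair (n, j) of positive
   integers is represented by (n.-1, j.-1).  As this relabelling preserves the
   order, only ranges j = 1, ..., m change form: they become j <= m. *)
Definition subdiagonal (B : set (nat * nat)) : Prop :=
  B `<=` [set p | (p.2 < p.1)%N].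

Definition admissible (B : set (nat * nat)) : Prop :=
  B `<=` [set p | p.1 != p.2] /\
  forall m : nat, exists2 n : nat, (m < n)%N &
    forall j : nat, (j <= m)%N -> ~ B (j, n) /\ ~ B (n, j).

(* Main.v *)
(* Since [T - lambda] is not compact, [W_e(T)] has a point other than [lambda];
   hence it has two points [lam], [mu] further apart than half its diameter.
   After replacing [T] by [S = 2 / (lam - mu) * (T - (lam + mu) / 2)], both [1]
   and [-1] lie in [W_e(S)], the prescribed entries have row and column sums at
   most [1 / 100], and there are unit vectors [v] with [<S v, v>] arbitrarily
   close to [1] or [-1] and subject to finitely many orthogonality conditions.

   The basis is built vector by vector as [u_n = o + b + t (v_n^+ + v_n^-)], with
   fresh unit vectors [v_n^+], [v_n^-] for the two signs, [b] in the span of the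
   earlier fresh vectors and [o] small.  As [<S u_j, v_i^+>] is close to
   [<u_j, v_i^+>], but [<S u_j, v_i^->] to [- <u_j, v_i^->], the functionals given
   by [u_j] and [S u_j] are uniformly independent on the span of the fresh
   vectors, so [b] can be orthogonal to the [u_j] and produce the entries of row
   [n] in the recent columns.  In the finitely many old columns the remaining
   entries are tiny, and [o] produces them.  Admissibility provides rows without
   entries in the old columns; there [o] is free, and is taken along the
   component of a vector [y] of a dense sequence orthogonal to the span of
   [u_0, ..., u_(n-1)].  This multiplies the squared distance from [y] to the span
   by a fixed factor [< 1], so that infinitely many such rows for each [y] make
   the orthonormal sequence complete. *)
From HB Require Import structures.
Require Import Defs.
From mathcomp Require Import all_boot all_order all_algebra complex.
From mathcomp Require Import all_classical all_reals all_analysis.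
From mathcomp Require Import ring lra.
Set Implicit Arguments.
Unset Strict Implicit.
Unset Printing Implicit Defensive.
Import Order.TTheory GRing.Theory Num.Theory.
Import numFieldNormedType.Exports.
Import Normc.
Local Open Scope classical_set_scope.
Local Open Scope ring_scope.
Local Open Scope complex_scope.

(** One row is easy to place; the difficulty is that infinitely many rows must not use up the
    visibility of a column in the fresh coordinates ([inv_star]). The vector [b] of a new row
    overlaps with the recent columns, and its norm need not shrink from row to row, so that a norm
    estimate of the overlap is useless. But for [X] in the span of the recent columns, the parts of
    [<X, b>] carried by the two signs have sum [0], as [b] is orthogonal to the columns, and
    difference close to [<S X, b>], which is prescribed. Hence column [j] loses only about
    [|a_nj| / 2] at row [n]. As in a Schur test, column sums bound the total loss of a column and
    row sums the initial loss of a new one.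

    The losses due to [o] are of another kind: each of the infinitely many rows that absorb a target
    costs every recent column the same fixed amount. So columns have to retire. An old column is
    protected by [inv_gold] alone, whose constant may decay from era to era: the entries of later
    rows in the old columns are summable, so an era can start as late as its constant demands. *)

Local Notation cj := (@conjc _).

(** * Moduli of complex numbers *)

(* Locked, since lemmas such as [big_split] would otherwise see the sum. *)
HB.lock Definition sqm (R : realType) (z : R[i]) : R :=
  complex.Re z ^+ 2 + complex.Im z ^+ 2.

Section SquaredModulus.
Variable R : realType.
Implicit Types z w : R[i].

Lemma modulusE z : modulus z = Num.sqrt (sqm z).
Proof. by rewrite unlock; case: z. Qed.

Lemma sqm_ge0 z : 0 <= sqm z.
Proof. by rewrite unlock addr_ge0 ?sqr_ge0. Qed.

Lemma modulus_ge0 z : 0 <= modulus z.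
Proof. by rewrite modulusE sqrtr_ge0. Qed.

Lemma sqr_modulus z : modulus z ^+ 2 = sqm z.
Proof. by rewrite modulusE sqr_sqrtr // sqm_ge0. Qed.

Lemma normrE z : `|z| = (modulus z)%:C.
Proof. by rewrite normc_def modulusE unlock. Qed.

Lemma sqmM z w : sqm (z * w) = sqm z * sqm w.
Proof. by rewrite -!sqr_modulus normcM exprMn. Qed.

Lemma sqm0 : sqm (0 : R[i]) = 0.
Proof. by rewrite unlock /= expr0n addr0. Qed.

Lemma sqm_eq0 z : sqm z = 0 -> z = 0.
Proof. by rewrite -sqr_modulus => /eqP; rewrite sqrf_eq0 => /eqP /eq0_normc. Qed.

Lemma sqmJ z : sqm (cj z) = sqm z.
Proof. by case: z => a b; rewrite unlock /= sqrrN. Qed.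

Lemma sqmN z : sqm (- z) = sqm z.
Proof. by case: z => a b; rewrite unlock /= !sqrrN. Qed.

Lemma modulusJ z : modulus (cj z) = modulus z.
Proof. by rewrite !modulusE sqmJ. Qed.

Lemma mulJ z : z * cj z = (sqm z)%:C.
Proof. by case: z => a b; rewrite unlock; simpc; congr (_ +i* _); ring. Qed.

Lemma sqmR (r : R) : sqm r%:C = r ^+ 2.
Proof. by rewrite unlock /= expr0n addr0. Qed.

Lemma modulusR (r : R) : modulus r%:C = `|r|.
Proof. by rewrite modulusE sqmR sqrtr_sqr. Qed.

Lemma modulus_nat n : modulus (n%:R : R[i]) = n%:R.
Proof. by rewrite -(rmorph_nat (real_complex R)) modulusR ger0_norm. Qed.

Lemma ReD z w : complex.Re (z + w) = complex.Re z + complex.Re w.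
Proof. by case: z w => [a b] [c d]. Qed.

Lemma ReN z : complex.Re (- z) = - complex.Re z.
Proof. by case: z. Qed.

Lemma ReJ z : complex.Re (cj z) = complex.Re z.
Proof. by case: z. Qed.

Lemma ReZ (r : R) z : complex.Re (r%:C * z) = r * complex.Re z.
Proof. by case: z => a b; simpc. Qed.

Lemma Re_sum (I : Type) (r : seq I) (P : pred I) (F : I -> R[i]) :
  complex.Re (\sum_(i <- r | P i) F i) = \sum_(i <- r | P i) complex.Re (F i).
Proof. by apply: (big_morph (@complex.Re R)) => // x y; rewrite ReD. Qed.

Lemma sqmD z w : sqm (z + w) = sqm z + sqm w + 2 * complex.Re (z * cj w).
Proof. by case: z w => [a b] [c d]; rewrite unlock; simpc => /=; ring. Qed.

Lemma sqmD_le z w : sqm (z + w) <= 2 * sqm z + 2 * sqm w.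
Proof.
have : 0 <= sqm (z - w) by exact: sqm_ge0.
case: z w => [a b] [c d]; rewrite unlock; simpc => /=; nra.
Qed.

Lemma sqmD_ge z w : 2^-1 * sqm z - sqm w <= sqm (z + w).
Proof.
have := sqmD_le (z + w) (- w); rewrite addrK sqmN => h.
by rewrite lerBlDr -(ler_pM2l (_ : 0 < 2 :> R))// mulrA divff ?pnatr_eq0// mul1r mulrDr.
Qed.

Lemma sqm_parallelogram z w : sqm (z + w) + sqm (z - w) = 2 * sqm z + 2 * sqm w.
Proof. by case: z w => [a b] [c d]; rewrite unlock; simpc => /=; ring. Qed.

Lemma Re_le_modulus z : complex.Re z <= modulus z.
Proof.
rewrite modulusE; apply: (le_trans (ler_norm _)).
by rewrite -sqrtr_sqr ler_wsqrtr // unlock lerDl sqr_ge0.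
Qed.

Lemma sqr_Re_le z : complex.Re z ^+ 2 <= sqm z.
Proof. by rewrite unlock lerDl sqr_ge0. Qed.

Lemma normRe_le_modulus z : `|complex.Re z| <= modulus z.
Proof.
by rewrite modulusE -sqrtr_sqr ler_wsqrtr // unlock lerDl sqr_ge0.
Qed.

Lemma modulus_sum (I : Type) (r : seq I) (P : pred I) (F : I -> R[i]) :
  modulus (\sum_(i <- r | P i) F i) <= \sum_(i <- r | P i) modulus (F i).
Proof.
elim/big_rec2: _ => [|i x y _ h]; first by rewrite normc0.
by apply: (le_trans (le_normcD _ _)); rewrite lerD2l.
Qed.

Lemma modulus_le z (r : R) : 0 <= r -> (modulus z <= r) = (sqm z <= r ^+ 2).
Proof.
by move=> r0; rewrite -sqr_modulus ler_pXn2r// nnegrE modulus_ge0.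
Qed.

End SquaredModulus.


Lemma cauchy_schwarz_sum (R : realType) (I : Type) (r : seq I) (P : pred I)
    (a b : I -> R[i]) :
  sqm (\sum_(i <- r | P i) a i * b i) <=
    (\sum_(i <- r | P i) sqm (a i)) * (\sum_(i <- r | P i) sqm (b i)).
Proof.
elim: r => [|i r IH]; first by rewrite !big_nil sqm0 mul0r.
rewrite !big_cons; case: (P i) => //.
move: IH.
set s := \sum_(_ <- _ | _) (_ * _); set A := \sum_(_ <- _ | _) sqm (a _).
set B := \sum_(_ <- _ | _) _ => h.
have A0 : 0 <= A by apply: sumr_ge0 => *; exact: sqm_ge0.
have B0 : 0 <= B by apply: sumr_ge0 => *; exact: sqm_ge0.
have x0 := sqm_ge0 (a i); have y0 := sqm_ge0 (b i).
have hs : modulus s <= Num.sqrt A * Num.sqrt B.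
  rewrite -sqrtrM // modulusE ler_wsqrtr //.
have hab : modulus (a i * b i) = Num.sqrt (sqm (a i)) * Num.sqrt (sqm (b i)).
  by rewrite normcM !modulusE.
rewrite -sqr_modulus.
apply: (@le_trans _ _ ((Num.sqrt (sqm (a i)) * Num.sqrt (sqm (b i)) +
    Num.sqrt A * Num.sqrt B) ^+ 2)).
  have s0 : 0 <= Num.sqrt (sqm (a i)) * Num.sqrt (sqm (b i)) + Num.sqrt A * Num.sqrt B.
    by rewrite addr_ge0 // mulr_ge0 // sqrtr_ge0.
  rewrite ler_sqr ?nnegrE ?modulus_ge0 //.
  by apply: (le_trans (le_normcD _ _)); rewrite hab lerD2l.
have -> : (sqm (a i) + A) * (sqm (b i) + B) =
  (Num.sqrt (sqm (a i)) ^+ 2 + Num.sqrt A ^+ 2) * (Num.sqrt (sqm (b i)) ^+ 2 + Num.sqrt B ^+ 2).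
  by rewrite !sqr_sqrtr.
have := sqr_ge0 (Num.sqrt (sqm (a i)) * Num.sqrt B - Num.sqrt A * Num.sqrt (sqm (b i))).
set p := Num.sqrt _; set q := Num.sqrt A; set u := Num.sqrt _; set v := Num.sqrt _.
nra.
Qed.

(** * Inner products *)

Section InnerProduct.
Variables (R : realType) (V : lmodType R[i]) (ip : {dot V for @Num.conj R[i]}).
Implicit Types (x y z : V) (a : R[i]).

Lemma ipC x y : ip x y = cj (ip y x).
Proof. by rewrite (hermitian_subproof x y) expr0 mul1r. Qed.

Lemma ipDl x y z : ip (x + y) z = ip x z + ip y z.
Proof. exact: linearDl. Qed.

Lemma ipDr x y z : ip x (y + z) = ip x y + ip x z.
Proof. exact: linearDr. Qed.

Lemma ipNl x y : ip (- x) y = - ip x y.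
Proof. exact: linearNl. Qed.

Lemma ipNr x y : ip x (- y) = - ip x y.
Proof. exact: linearNr. Qed.

Lemma ipBl x y z : ip (x - y) z = ip x z - ip y z.
Proof. exact: linearBl. Qed.

Lemma ipBr x y z : ip x (y - z) = ip x y - ip x z.
Proof. exact: linearBr. Qed.

Lemma ipZl a x y : ip (a *: x) y = a * ip x y.
Proof. exact: linearZl_LR. Qed.

Lemma ipZr a x y : ip x (a *: y) = cj a * ip x y.
Proof. exact: linearZr_LR. Qed.

Lemma ip0l x : ip 0 x = 0.
Proof. exact: linear0l. Qed.

Lemma ip0r x : ip x 0 = 0.
Proof. exact: linear0r. Qed.

Lemma ip_suml (I : Type) (r : seq I) (P : pred I) (F : I -> V) y :
  ip (\sum_(i <- r | P i) F i) y = \sum_(i <- r | P i) ip (F i) y.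
Proof. exact: linear_sumlz. Qed.

Lemma ip_sumr (I : Type) (r : seq I) (P : pred I) (F : I -> V) y :
  ip y (\sum_(i <- r | P i) F i) = \sum_(i <- r | P i) ip y (F i).
Proof. exact: linear_sumr. Qed.

Definition N2 x : R := complex.Re (ip x x).

Lemma ipxx x : ip x x = (N2 x)%:C.
Proof.
rewrite /N2; have := ipC x x; case: (ip x x) => a b /= [] h.
by congr (_ +i* _); lra.
Qed.

Lemma N2_gt0 x : x != 0 -> 0 < N2 x.
Proof. by move=> /(neq0_dnorm_gt0 (s := ip)); rewrite ipxx ltcR. Qed.

Lemma N20 : N2 0 = 0.
Proof. by rewrite /N2 ip0l. Qed.

Lemma N2_ge0 x : 0 <= N2 x.
Proof. by case: (eqVneq x 0) => [->|/N2_gt0/ltW//]; rewrite N20. Qed.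

Lemma N2_eq0 x : N2 x = 0 -> x = 0.
Proof. by move=> h; apply/eqP; apply: contraT => /N2_gt0; rewrite h ltxx. Qed.

Lemma N2Z a x : N2 (a *: x) = sqm a * N2 x.
Proof.
by rewrite {1}/N2 ipZl ipZr mulrA mulJ ReZ.
Qed.

Lemma N2N x : N2 (- x) = N2 x.
Proof. by rewrite /N2 ipNl ipNr opprK. Qed.

Lemma N2D x y : N2 (x + y) = N2 x + N2 y + 2 * complex.Re (ip x y).
Proof.
rewrite /N2 ipDl !ipDr !ReD (ipC y x) ReJ; ring.
Qed.

Lemma N2B x y : N2 (x - y) = N2 x + N2 y - 2 * complex.Re (ip x y).
Proof. by rewrite N2D N2N ipNr ReN mulrN. Qed.

Lemma N2D_orth x y : ip x y = 0 -> N2 (x + y) = N2 x + N2 y.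
Proof. by rewrite N2D => -> /=; rewrite mulr0 addr0. Qed.

Lemma N2D_le x y : N2 (x + y) <= 2 * N2 x + 2 * N2 y.
Proof. have := N2_ge0 (x - y); rewrite N2B N2D; lra. Qed.

Lemma cauchy_schwarz x y : sqm (ip x y) <= N2 x * N2 y.
Proof.
case: (eqVneq y 0) => [->|y0]; first by rewrite ip0r sqm0 N20 mulr0.
have Y := N2_gt0 y0.
have := N2_ge0 (((N2 y)%:C) *: x - (ip x y) *: y).
rewrite N2B !N2Z ipZl ipZr [cj _ * _]mulrC mulJ -rmorphM /= sqmR.
have -> : N2 y ^+ 2 * N2 x + sqm (ip x y) * N2 y - 2 * (N2 y * sqm (ip x y)) =
  N2 y * (N2 x * N2 y - sqm (ip x y)) by ring.
by rewrite pmulr_rge0 // subr_ge0.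
Qed.

Definition nrm x : R := Num.sqrt (N2 x).

Lemma nrm_ge0 x : 0 <= nrm x.
Proof. exact: sqrtr_ge0. Qed.

Lemma sqr_nrm x : nrm x ^+ 2 = N2 x.
Proof. by rewrite sqr_sqrtr // N2_ge0. Qed.

Lemma nrm_le x (r : R) : 0 <= r -> (nrm x <= r) = (N2 x <= r ^+ 2).
Proof. by move=> r0; rewrite -sqr_nrm ler_pXn2r// nnegrE nrm_ge0. Qed.

Lemma nrmZ a x : nrm (a *: x) = modulus a * nrm x.
Proof. by rewrite /nrm N2Z modulusE sqrtrM // sqm_ge0. Qed.

Lemma nrmN x : nrm (- x) = nrm x.
Proof. by rewrite /nrm N2N. Qed.

Lemma modulus_ip x y : modulus (ip x y) <= nrm x * nrm y.
Proof.
rewrite modulus_le ?mulr_ge0 ?nrm_ge0// exprMn !sqr_nrm; exact: cauchy_schwarz.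
Qed.

Lemma nrmD x y : nrm (x + y) <= nrm x + nrm y.
Proof.
rewrite nrm_le ?addr_ge0 ?nrm_ge0// N2D sqrrD !sqr_nrm.
have := le_trans (Re_le_modulus _) (modulus_ip x y); rewrite -mulr_natl; lra.
Qed.

Section Orthonormal.
Variables (I : eqType) (r : seq I) (e : I -> V).
Hypothesis r_uniq : uniq r.
Hypothesis e_orth :
  forall i j, i \in r -> j \in r -> ip (e i) (e j) = (i == j)%:R.

Lemma ip_comb (c : I -> R[i]) j : j \in r ->
  ip (\sum_(i <- r) c i *: e i) (e j) = c j.
Proof.
move=> jr; rewrite ip_suml (bigD1_seq j) //= ipZl e_orth// eqxx mulr1.
rewrite big_seq_cond big1 ?addr0// => i /andP[ir ij].
by rewrite ipZl e_orth// (negbTE ij) mulr0.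
Qed.

Lemma ip_combr (c : I -> R[i]) x :
  ip x (\sum_(i <- r) c i *: e i) = \sum_(i <- r) cj (c i) * ip x (e i).
Proof. by rewrite ip_sumr; apply: eq_bigr => i _; rewrite ipZr. Qed.

Lemma N2_comb (c : I -> R[i]) :
  N2 (\sum_(i <- r) c i *: e i) = \sum_(i <- r) sqm (c i).
Proof.
rewrite {1}/N2 ip_combr big_seq (eq_bigr (fun i => (sqm (c i))%:C)).
  by rewrite Re_sum -big_seq.
by move=> i ir; rewrite ip_comb // mulrC mulJ.
Qed.

Lemma N2_proj x :
  N2 (x - \sum_(i <- r) ip x (e i) *: e i) = N2 x - \sum_(i <- r) sqm (ip x (e i)).
Proof.
rewrite N2B N2_comb ip_combr (eq_bigr (fun i => (sqm (ip x (e i)))%:C)).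
  by rewrite Re_sum /=; lra.
by move=> i _; rewrite mulrC mulJ.
Qed.

Lemma bessel x : \sum_(i <- r) sqm (ip x (e i)) <= N2 x.
Proof. by rewrite -subr_ge0 -N2_proj N2_ge0. Qed.

Lemma proj_orth x j : j \in r ->
  ip (x - \sum_(i <- r) ip x (e i) *: e i) (e j) = 0.
Proof. by move=> jr; rewrite ipBl ip_comb // subrr. Qed.

End Orthonormal.

(* Gram-Schmidt step: the last vector minus its solution [b'] against the
   previous ones is orthogonal to them, and nonzero by independence. *)
Lemma gram_solve_ind (g : nat -> V) n :
  (forall c : nat -> R[i], \sum_(j < n) c j *: g j = 0 -> forall j, (j < n)%N -> c j = 0) ->
  forall l : nat -> R[i], exists c : nat -> R[i], forall j, (j < n)%N ->
    ip (g j) (\sum_(i < n) c i *: g i) = l j.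
Proof.
elim: n => [|n IH] free l; first by exists (fun=> 0).
have free' (c : nat -> R[i]) : \sum_(j < n) c j *: g j = 0 -> forall j, (j < n)%N -> c j = 0.
  move=> h j jn; pose c' k := if (k < n)%N then c k else 0.
  have := free c' _ j (ltnW jn); rewrite /c' jn; apply.
  rewrite big_ord_recr /= ltnn scale0r addr0 -[RHS]h.
  by apply: eq_bigr => i _; rewrite ltn_ord.
have [c0 h0] := IH free' l.
have [c1 h1] := IH free' (fun j => ip (g j) (g n)).
pose b0 := \sum_(i < n) c0 i *: g i.
pose b1 := \sum_(i < n) c1 i *: g i.
pose h := g n - b1.
have hg j : (j < n)%N -> ip (g j) h = 0 by move=> jn; rewrite ipBr h1 // subrr.
have hb1 : ip b1 h = 0.
  rewrite ip_suml big1// => i _; by rewrite ipZl hg// mulr0.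
have hn : ip (g n) h = (N2 h)%:C by rewrite -ipxx {2}/h ipBl hb1 subr0.
have h_neq0 : (N2 h)%:C != 0.
  apply/eqP => -[] /N2_eq0 /subr0_eq E.
  have := free (fun k => if (k < n)%N then c1 k else -1) _ n (ltnSn n).
  rewrite ltnn big_ord_recr /= ltnn scaleN1r.
  rewrite (eq_bigr (fun i : 'I_n => c1 i *: g i)); last by move=> i _; rewrite ltn_ord.
  rewrite -/b1 -E subrr => /(_ erefl)/eqP.
  by rewrite oppr_eq0 oner_eq0.
pose a := cj ((l n - ip (g n) b0) / (N2 h)%:C).
exists (fun k => if (k < n)%N then c0 k - a * c1 k else a) => j.
have -> : \sum_(i < n.+1) (if (i < n)%N then c0 i - a * c1 i else a) *: g i = b0 + a *: h.
  rewrite big_ord_recr /= ltnn /h scalerBr /b0 /b1 scaler_sumr addrCA addrC; congr (_ + _).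
  rewrite -sumrB; apply: eq_bigr => i _.
  by rewrite ltn_ord scalerBl scalerA.
rewrite ltnS leq_eqVlt ipDr ipZr => /predU1P[->|jn].
  have -> : cj a = (l n - ip (g n) b0) / (N2 h)%:C by exact: conjcK.
  by rewrite hn divfK // addrC subrK.
by rewrite h0 // hg // mulr0 addr0.
Qed.

(** [N2 b] is the real part of the sum of the [c j * l j]. Cauchy-Schwarz bounds its square by the
    squared sizes of [c] and [l], and the lower bound of the Gram form trades the first for
    [N2 b / rho]. The resulting bound does not depend on [n]. *)
Lemma gram_solve (g : nat -> V) n (rho : R) (l : nat -> R[i]) : 0 < rho ->
  (forall c : nat -> R[i], rho * (\sum_(j < n) sqm (c j)) <= N2 (\sum_(j < n) c j *: g j)) ->
  exists c : nat -> R[i], let b := \sum_(i < n) c i *: g i in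
    (forall j, (j < n)%N -> ip (g j) b = l j) /\
    rho * N2 b <= \sum_(j < n) sqm (l j).
Proof.
move=> rho0 low.
have free (c : nat -> R[i]) : \sum_(j < n) c j *: g j = 0 -> forall j, (j < n)%N -> c j = 0.
  move=> h j jn; apply: sqm_eq0; apply: le_anti; rewrite sqm_ge0 andbT.
  have := low c; rewrite h N20 pmulr_rle0 // => H.
  apply: (le_trans _ H).
  by rewrite (bigD1 (Ordinal jn)) //= lerDl sumr_ge0 // => *; exact: sqm_ge0.
have [c hc] := gram_solve_ind free l; exists c => b; split=> //.
have E : N2 b = complex.Re (\sum_(j < n) c j * l j).
  rewrite /N2 {1}/b ip_suml; congr complex.Re.
  by apply: eq_bigr => i _; rewrite ipZl hc.
have : N2 b ^+ 2 <= (\sum_(j < n) sqm (c j)) * (\sum_(j < n) sqm (l j)).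
  apply: le_trans (cauchy_schwarz_sum _ _ _ _).
  by rewrite E sqr_Re_le.
have := low c; rewrite -/b.
set s := \sum_(j < n) sqm (c j); set t := \sum_(j < n) _ => h1 h2.
have t0 : 0 <= t by apply: sumr_ge0 => *; exact: sqm_ge0.
have := N2_ge0 b; rewrite le_eqVlt => /predU1P[<-|b0]; first by rewrite mulr0.
rewrite -(ler_pM2l b0); apply: (le_trans _ (ler_wpM2r t0 h1)).
by rewrite mulrCA -mulrA ler_pM2l // -expr2.
Qed.

End InnerProduct.

(** * Invariant of the construction *)

Section RowSolve.
Variables (R : realType) (V : lmodType R[i]) (ip : {dot V for @Num.conj R[i]}).
Variables (S : {linear V -> V}) (y : nat -> V) (eps : nat -> R).

Definition sgn (b : bool) : R[i] := if b then 1 else -1.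

Definition idx (p n : nat) : seq (nat * bool) :=
  [seq (i, b) | i <- index_iota p n, b <- [:: true; false]].

Lemma mem_idx p n k : (k \in idx p n) = (p <= k.1 < n)%N.
Proof.
case: k => i b; apply/allpairsP/idP => /= [[[i' b'] /= [h1 h2 [-> _]]]|h].
  by rewrite -mem_index_iota.
by exists (i, b); rewrite /= mem_index_iota; split=> //; case: (b).
Qed.

Lemma uniq_idx p n : uniq (idx p n).
Proof. by apply: allpairs_uniq; rewrite ?iota_uniq // => -[i b] [i' b']. Qed.

Lemma sum_idx (M : nmodType) p n (F : nat * bool -> M) :
  \sum_(k <- idx p n) F k = \sum_(p <= i < n) (F (i, true) + F (i, false)).
Proof.
rewrite /idx big_allpairs_dep /=; apply: eq_bigr => i _.
by rewrite !big_cons big_nil addr0.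
Qed.

Variables (u : nat -> V) (v : nat * bool -> V).

Definition lam k := ip (S (v k)) (v k).

Definition comb (p n : nat) (c : nat -> R[i]) := \sum_(p <= j < n) c j *: u j.

(* State after [n] rows.  Columns [j < p] are old: they only enter through
   [inv_gold], a lower bound for the distance from [S x] to the span of the
   [u l], for [x] in the span of the old columns.  On the columns in [p, n) the
   action of [S] is read off the fresh vectors [v] ([inv_K]), and [inv_star]
   keeps these columns visible from both the [+] and the [-] fresh vectors. *)
Record inv (n p : nat) (w : nat -> R) (rho : R) : Prop := Inv {
  inv_pn : (p <= n)%N;
  inv_u : forall i j, (i < n)%N -> (j < n)%N -> ip (u i) (u j) = (i == j)%:R;
  inv_v : forall k l, (k.1 < n)%N -> (l.1 < n)%N -> ip (v k) (v l) = (k == l)%:R;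
  inv_Sv : forall k l, (k.1 < n)%N -> (l.1 < n)%N -> k != l -> ip (S (v k)) (v l) = 0;
  inv_lam : forall k, (k.1 < n)%N -> modulus (lam k - sgn k.2) <= eps k.1;
  inv_fresh : forall k, (k.1 < n)%N -> forall j, (j < k.1)%N ->
    [/\ ip (u j) (v k) = 0, ip (S (u j)) (v k) = 0 & ip (S (S (u j))) (v k) = 0];
  inv_y : forall k, (k.1 < n)%N -> forall t, (t <= k.1)%N ->
    ip (y t) (v k) = 0 /\ ip (S (y t)) (v k) = 0;
  inv_K : forall j, (j < n)%N -> forall k, (p <= k.1 < n)%N ->
    ip (S (u j)) (v k) = lam k * ip (u j) (v k);
  inv_nz : forall k, (k.1 < n)%N -> ip (u k.1) (v k) != 0;
  inv_star : forall b c, \sum_(p <= j < n) w j * sqm (c j) <=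
    \sum_(p <= i < n) sqm (ip (comb p n c) (v (i, b)));
  inv_gold : forall c, rho * (\sum_(0 <= j < p) sqm (c j)) <=
    N2 ip (S (comb 0 p c)) - \sum_(0 <= l < n) sqm (ip (S (comb 0 p c)) (u l)) }.

Variables (n p : nat) (w : nat -> R) (rho : R).
Hypothesis I : inv n p w rho.

Lemma u_orth q : forall i j, i \in index_iota q n -> j \in index_iota q n ->
  ip (u i) (u j) = (i == j)%:R.
Proof.
by move=> i j; rewrite !mem_index_iota => /andP[_ h] /andP[_ h']; exact: (inv_u I).
Qed.

Lemma v_orth q : forall i j, i \in idx q n -> j \in idx q n ->
  ip (v i) (v j) = (i == j)%:R.
Proof.
by move=> i j; rewrite !mem_idx => /andP[_ h] /andP[_ h']; exact: (inv_v I).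
Qed.

Lemma N2_combE q m c : (m <= n)%N -> N2 ip (comb q m c) = \sum_(q <= j < m) sqm (c j).
Proof.
move=> mn; rewrite /comb (N2_comb (iota_uniq _ _)) // => i j.
rewrite !mem_index_iota => /andP[_ h] /andP[_ h'].
by apply: (inv_u I); exact: leq_trans mn.
Qed.

(** Seen through the recent fresh vectors, [S] acts on [h] as the diagonal with entries [lam k].
    Each summand of a new row has to satisfy this for [inv_K] to persist. *)
Definition diag_on (h : V) := forall k, (p <= k.1 < n)%N ->
  ip (S h) (v k) = lam k * ip h (v k).

Lemma diag_onB h h' : diag_on h -> diag_on h' -> diag_on (h - h').
Proof. by move=> d d' k hk; rewrite linearB !ipBl d // d' // mulrBr. Qed.

Lemma diag_onZ a h : diag_on h -> diag_on (a *: h).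
Proof. by move=> d k hk; rewrite linearZ /= !ipZl d // mulrCA. Qed.

Lemma diag_on_sum q m c (f : nat -> V) :
  (forall j, (q <= j < m)%N -> diag_on (f j)) ->
  diag_on (\sum_(q <= j < m) c j *: f j).
Proof.
move=> d k hk; rewrite linear_sum !ip_suml mulr_sumr big_nat [RHS]big_nat.
by apply: eq_bigr => j hj; exact: diag_onZ (d j hj) k hk.
Qed.

Lemma comb_K c : diag_on (comb p n c).
Proof. by apply: diag_on_sum => j /andP[_ jn]; exact: (inv_K I). Qed.

(** Both sides vanish, because the later fresh vectors are orthogonal to [S (u j)] and to
    [S (S (u j))]; for this reason [inv_fresh] includes the second iterate. *)
Lemma diag_on_image j : (j < p)%N -> diag_on (S (u j)).
Proof.
move=> jp k /andP[pk kn]; have [_ E1 E2] := inv_fresh I kn (leq_trans jp pk).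
by rewrite E1 E2 mulr0.
Qed.

Hypothesis w_ge : forall j, (p <= j < n)%N -> 4^-1 <= w j.
Hypothesis eps_le : forall i, (p <= i < n)%N -> eps i <= 100^-1.

Let m := (n - p)%N.
(** [D j] and, by [inv_K], [J j] are the projections of [u j] and [S (u j)] to the span of the
    recent fresh vectors. The family [g] lists first the [D] and then the [J], so that a single
    linear system expresses both requirements on [b]. *)
Let D j := \sum_(k <- idx p n) ip (u j) (v k) *: v k.
Let J j := \sum_(k <- idx p n) (lam k * ip (u j) (v k)) *: v k.
Let X (c : nat -> R[i]) := comb p n (fun j => c (j - p)%N).
Let g j := if (j < m)%N then D (p + j)%N else J (p + (j - m))%N.

Let sum_shift (M : nmodType) (F : nat -> M) :
  \sum_(p <= j < n) F j = \sum_(j < m) F (p + j)%N.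
Proof.
by rewrite -{1}(add0n p) big_addn big_mkord; apply: eq_bigr => i _; rewrite addnC.
Qed.

Let comb_g (c : nat -> R[i]) : \sum_(j < m + m) c j *: g j =
  \sum_(k <- idx p n)
    (ip (X c) (v k) + lam k * ip (X (fun j => c (m + j)%N)) (v k)) *: v k.
Proof.
rewrite big_split_ord /=.
under [X in _ = X]eq_bigr => k _ do rewrite scalerDl.
rewrite big_split /=; congr (_ + _).
- rewrite (eq_bigr (fun j : 'I_m => \sum_(k <- idx p n) (c j * ip (u (p + j)%N) (v k)) *: v k)).
    rewrite exchange_big /=; apply: eq_bigr => k _; rewrite -scaler_suml; congr (_ *: _).
    rewrite /X /comb ip_suml sum_shift; apply: eq_bigr => j _.
    by rewrite ipZl addKn.
  move=> j _; rewrite /g ltn_ord /D scaler_sumr; apply: eq_bigr => k _.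
  by rewrite scalerA.
- rewrite (eq_bigr (fun j : 'I_m => \sum_(k <- idx p n)
      (c (m + j)%N * (lam k * ip (u (p + j)%N) (v k))) *: v k)).
    rewrite exchange_big /=; apply: eq_bigr => k _; rewrite -scaler_suml; congr (_ *: _).
    rewrite /X /comb ip_suml sum_shift mulr_sumr; apply: eq_bigr => j _.
    by rewrite ipZl addKn mulrCA.
  move=> j _; rewrite /g ltnNge leq_addr /= addKn /J scaler_sumr; apply: eq_bigr => k _.
  by rewrite scalerA.
Qed.

Let N2_X (c : nat -> R[i]) : N2 ip (X c) = \sum_(j < m) sqm (c j).
Proof.
by rewrite /X N2_combE // sum_shift; apply: eq_bigr => j _; rewrite addKn.
Qed.

Let low_star b (c : nat -> R[i]) : 4^-1 * \sum_(j < m) sqm (c j) <=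
  \sum_(p <= i < n) sqm (ip (X c) (v (i, b))).
Proof.
apply: le_trans (inv_star I b (fun j => c (j - p)%N)).
rewrite sum_shift mulr_sumr; apply: ler_sum => j _; rewrite addKn.
by rewrite ler_wpM2r ?sqm_ge0 // w_ge // leq_addr /= -ltn_subRL ltn_ord.
Qed.

(** On a [+] fresh vector the coordinate is close to that of [c + c2], on a [-] one to that of
    [c - c2]. Each sign bounds its combination below with the constant [1/4], and the parallelogram
    identity adds this up to [1/2] on [c] and [c2]. Half of it remains after [sqmD_ge], and the
    error [1/100] still leaves more than [1/5]. *)
Let low_g (c : nat -> R[i]) :
  5^-1 * (\sum_(j < m + m) sqm (c j)) <= N2 ip (\sum_(j < m + m) c j *: g j).
Proof.
rewrite comb_g (N2_comb (uniq_idx p n) (@v_orth p)).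
set c2 := fun j => c (m + j)%N.
have Xlin b : X (fun j => c j + sgn b * c2 j) = X c + sgn b *: X c2.
  rewrite /X /comb scaler_sumr -big_split /=; apply: eq_bigr => j _.
  by rewrite scalerDl scalerA.
have h1 : \sum_(k <- idx p n) (2^-1 * sqm (ip (X (fun j => c j + sgn k.2 * c2 j)) (v k))
    - (10^-1) ^+ 2 * sqm (ip (X c2) (v k))) <=
  \sum_(k <- idx p n) sqm (ip (X c) (v k) + lam k * ip (X c2) (v k)).
  rewrite big_seq [leRHS]big_seq; apply: ler_sum => k; rewrite mem_idx => hk.
  have -> : ip (X c) (v k) + lam k * ip (X c2) (v k) =
    ip (X (fun j => c j + sgn k.2 * c2 j)) (v k) + (lam k - sgn k.2) * ip (X c2) (v k).
    by rewrite Xlin ipDl ipZl; ring.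
  apply: le_trans (sqmD_ge _ _); rewrite lerD2l lerN2 sqmM ler_wpM2r ?sqm_ge0//.
  have kn : (k.1 < n)%N by case/andP: hk.
  rewrite -modulus_le ?invr_ge0//; apply: (le_trans (inv_lam I kn)).
  apply: (le_trans (eps_le hk)); lra.
apply: le_trans h1; rewrite sumrB -!mulr_sumr sum_idx big_split.
have bes := bessel (uniq_idx p n) (@v_orth p) (X c2); rewrite N2_X in bes.
have lT := low_star true (fun j => c j + sgn true * c2 j).
have lF := low_star false (fun j => c j + sgn false * c2 j).
have par : \sum_(j < m) sqm (c j + sgn true * c2 j) + \sum_(j < m) sqm (c j + sgn false * c2 j)
  = 2 * (\sum_(j < m) sqm (c j)) + 2 * \sum_(j < m) sqm (c2 j).
  rewrite -big_split /= !mulr_sumr -big_split /=; apply: eq_bigr => j _.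
  by rewrite mul1r mulN1r sqm_parallelogram.
rewrite big_split_ord.
have p2 : 0 <= \sum_(j < m) sqm (c j) by apply: sumr_ge0 => *; exact: sqm_ge0.
have p3 : 0 <= \sum_(j < m) sqm (c2 j) by apply: sumr_ge0 => *; exact: sqm_ge0.
move: bes lT lF par p2 p3.
set s1 := \sum_(j < m) sqm (c j); set s2 := \sum_(j < m) sqm (c2 j).
set t1 := \sum_(k <- idx p n) _; set r1 := \sum_(j < m) _.
  set r2 := \sum_(j < m) sqm (_ + sgn false * _).
set tT := \sum_(p <= i < n) _; set tF := \sum_(p <= i < n) sqm (ip _ (v (i, false))).
rewrite /=; lra.
Qed.

(** As [b] lies in the fresh span, its products with [D j] and [J j] are those with [u j] and
    [S (u j)]. The old columns impose nothing: they and their images are orthogonal to the fresh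
    vectors from row [p] on. *)
Lemma row_solve (l : nat -> R[i]) : exists beta : nat * bool -> R[i],
  let b := \sum_(k <- idx p n) beta k *: v k in
  [/\ forall j, (j < n)%N -> ip (u j) b = 0,
      forall j, (p <= j < n)%N -> ip (S (u j)) b = l j,
      forall j, (j < p)%N -> ip (S (u j)) b = 0 &
      N2 ip b <= 5 * \sum_(p <= j < n) sqm (l j)].
Proof.
have [] := gram_solve (g := g) (n := (m + m)%N) (rho := 5^-1)
  (fun j => if (j < m)%N then 0 else l (p + (j - m))%N) _ low_g.
  by rewrite invr_gt0 ltr0n.
move=> c; cbv zeta; rewrite comb_g => -[].
pose beta k := ip (X c) (v k) + lam k * ip (X (fun j => c (m + j)%N)) (v k).
pose b := \sum_(k <- idx p n) beta k *: v k.
rewrite -[\sum_(k <- idx p n) _]/b => h1 h2.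
exists beta; cbv zeta; rewrite -/b.
have ipD j : ip (D j) b = ip (u j) b.
  rewrite /b !ip_combr; apply: eq_big_seq => k kI.
  by rewrite /D (ip_comb (uniq_idx p n) (@v_orth p)).
have ipJ j : (j < n)%N -> ip (J j) b = ip (S (u j)) b.
  move=> jn; rewrite /b !ip_combr; apply: eq_big_seq => k kI.
  rewrite /J (ip_comb (uniq_idx p n) (@v_orth p)) // (inv_K I jn) //.
  by rewrite -mem_idx.
have old j : (j < p)%N -> ip (u j) b = 0 /\ ip (S (u j)) b = 0.
  move=> jp; rewrite /b !ip_combr !big_seq; split; apply: big1 => k;
    rewrite mem_idx => /andP[pk kn];
    have [E1 E2 _] := inv_fresh I kn (leq_trans jp pk); rewrite ?E1 ?E2 mulr0 //.
have shift j : (p <= j < n)%N -> (j - p < m)%N.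
  by case/andP=> pj jn; rewrite /m ltn_sub2r // (leq_ltn_trans pj jn).
split.
- move=> j jn; case: (ltnP j p) => [/old[]//|pj].
  have jm : (j - p < m)%N by apply: shift; rewrite pj.
  rewrite -ipD -[j in D j](subnKC pj).
  have := h1 (j - p)%N (ltn_addl _ jm).
  by rewrite /g jm.
- move=> j jpn; have jm := shift _ jpn; case/andP: jpn => pj jn.
  rewrite -ipJ // -[j in J j](subnKC pj).
  have := h1 (m + (j - p))%N; rewrite ltn_add2l => /(_ jm).
  by rewrite /g ltnNge leq_addr /= addKn subnKC.
- by move=> j /old[].
- move: h2; rewrite big_split_ord /= big1; last first.
    by move=> i _; rewrite ltn_ord sqm0.
  rewrite add0r sum_shift.
  rewrite (eq_bigr (fun j : 'I_m => sqm (l (p + j)%N))); last first.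
    by move=> j _; rewrite ltnNge leq_addr /= addKn.
  by move: (\sum_(_ < _) _) => s; lra.
Qed.

End RowSolve.

(** * Old columns, and the overlap of a new row with the recent ones *)

Section RowStep.
Variables (R : realType) (V : lmodType R[i]) (ip : {dot V for @Num.conj R[i]}).
Variables (S : {linear V -> V}) (y : nat -> V) (eps : nat -> R).
Variables (u : nat -> V) (v : nat * bool -> V).
Variables (n p : nat) (w : nat -> R) (rho : R).
Hypothesis I : inv ip S y eps u v n p w rho.
Local Notation lam := (lam ip S v).
Local Notation comb := (comb u).
Local Notation N2 := (N2 ip).
Local Notation nrm := (nrm ip).

Lemma sum_combE (c d : nat -> R[i]) (q m : nat) (h : V) :
  (forall j, (q <= j < m)%N -> ip (S (u j)) h = d j) ->
  ip (S (comb q m c)) h = \sum_(q <= j < m) c j * d j.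
Proof.
move=> E; rewrite /comb linear_sum ip_suml !big_nat; apply: eq_bigr => j hj.
by rewrite linearZ /= ipZl E.
Qed.

(** The vector [o] is sought in the span of the projections of the [S (u j)], [j < p], to the
    complement of all columns; [inv_gold] is the lower bound of their Gram form. Such an [o]
    combines images of old columns with columns, hence is diagonal. *)
Lemma old_solve (l : nat -> R[i]) : 0 < rho -> exists o : V,
  [/\ forall j, (j < n)%N -> ip (u j) o = 0,
      forall j, (j < p)%N -> ip (S (u j)) o = l j,
      forall k, (p <= k.1 < n)%N -> ip (S o) (v k) = lam k * ip o (v k) &
      rho * N2 o <= \sum_(0 <= j < p) sqm (l j)].
Proof.
move=> rho0.
pose pr h := h - \sum_(0 <= l < n) ip h (u l) *: u l.
have uo := u_orth I (q := 0).
have pr_lin (c : nat -> R[i]) : \sum_(j < p) c j *: pr (S (u j)) = pr (S (comb 0 p c)).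
  rewrite /pr /comb linear_sum big_mkord.
  rewrite (eq_bigr (fun j : 'I_p => c j *: S (u j) -
      \sum_(0 <= l < n) (c j * ip (S (u j)) (u l)) *: u l)); last first.
    move=> j _; rewrite scalerBr scaler_sumr; congr (_ - _); apply: eq_bigr => i _.
    by rewrite scalerA.
  rewrite sumrB exchange_big /=; congr (_ - _).
    by apply: eq_bigr => j _; rewrite linearZ.
  apply: eq_bigr => i _; rewrite -scaler_suml ip_suml; congr (_ *: _).
  by apply: eq_bigr => j _; rewrite linearZ /= ipZl.
have low (c : nat -> R[i]) :
    rho * (\sum_(j < p) sqm (c j)) <= N2 (\sum_(j < p) c j *: pr (S (u j))).
  rewrite pr_lin (N2_proj (iota_uniq _ _) uo).
  by have := inv_gold I c; rewrite big_mkord.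
have [c] := gram_solve (g := fun j => pr (S (u j))) l rho0 low.
  cbv zeta; rewrite pr_lin => -[h1 h2].
set o := pr _ in h1 h2; exists o.
have ou j : (j < n)%N -> ip o (u j) = 0.
  by move=> jn; apply: (proj_orth (iota_uniq _ _) uo); rewrite mem_index_iota.
have uo0 j : (j < n)%N -> ip (u j) o = 0.
  by move=> jn; rewrite ipC ou // conjc0.
split=> //.
- move=> j jp; rewrite -(h1 j jp) /pr ipBl ip_suml.
  rewrite big_nat big1 ?subr0 // => i /andP[_ hi].
  by rewrite ipZl uo0 // mulr0.
- rewrite /o /pr /comb linear_sum.
  rewrite (eq_bigr (fun j => c j *: S (u j))); last by move=> j _; rewrite linearZ.
  apply: diag_onB; apply: diag_on_sum => j /andP[_ hj].
    exact: (diag_on_image I).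
  exact: (inv_K I).
- by rewrite big_mkord.
Qed.

Variables (M q e : R) (a : nat -> R[i]).
Hypothesis M0 : 0 <= M.
Hypothesis S_bound : forall x, N2 (S x) <= M ^+ 2 * N2 x.
Hypothesis q0 : 0 <= q.

Lemma nrm_S x : nrm (S x) <= M * nrm x.
Proof. by rewrite nrm_le ?mulr_ge0 ?nrm_ge0// exprMn sqr_nrm. Qed.

(* The functional [x |-> <S x, o>] has norm at most [M |o|]. *)
Lemma dual_bessel o :
  \sum_(p <= j < n) sqm (ip (S (u j)) o) <= M ^+ 2 * N2 o.
Proof.
set s := \sum_(_ <= _ < _) _.
have s0 : 0 <= s by apply: sumr_ge0 => *; exact: sqm_ge0.
pose c j := cj (ip (S (u j)) o).
have E : ip (S (comb p n c)) o = s%:C.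
  rewrite (@sum_combE _ (fun j => ip (S (u j)) o)) // /s rmorph_sum /=.
  by apply: eq_bigr => j _; rewrite mulrC mulJ.
have F : N2 (comb p n c) = s.
  by rewrite (N2_combE I) //; apply: eq_bigr => j _; rewrite sqmJ.
have := cauchy_schwarz ip (S (comb p n c)) o; rewrite E sqmR => h.
have := le_trans h (ler_wpM2r (N2_ge0 ip o) (S_bound _)); rewrite F.
move: s0; rewrite le_eqVlt => /predU1P[<- _|s0].
  by rewrite mulr_ge0 ?sqr_ge0 ?N2_ge0.
by move=> H; rewrite -(ler_pM2r s0) -expr2 mulrAC.
Qed.

(** [A true + A false] is [<X, b>], hence [0], and [A true - A false] is [<S X, b>] up to the
    deviation of [lam] from the signs, which accounts for [e]. In [<S X, b>] the sum of the
    [c j * a j] is corrected by [<S X, o>], which gives [M * q]; the direct overlap with [o] gives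
    [2 * q]. *)
Lemma cross_bound (o : V) (beta : nat * bool -> R[i]) (b0 : bool) (c : nat -> R[i]) :
  let b := \sum_(k <- idx p n) beta k *: v k in
  N2 o <= q ^+ 2 -> N2 b <= 1 -> 0 <= e ->
  (forall i, (p <= i < n)%N -> eps i <= e) ->
  (forall j, (j < n)%N -> ip (u j) b = 0) ->
  (forall j, (p <= j < n)%N -> ip (S (u j)) b = a j - ip (S (u j)) o) ->
  2 * modulus (\sum_(p <= i < n) ip (comb p n c) (v (i, b0)) * cj (ip (o + b) (v (i, b0))))
   <= \sum_(p <= j < n) modulus (c j) * modulus (a j) + ((M + 2) * q + e) * nrm (comb p n c).
Proof.
move=> b hq hb e0 heps ub sub.
set X := comb p n c.
have vo := v_orth I (q := p); have vu := uniq_idx p n.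
have bv i b1 : (p <= i < n)%N -> ip b (v (i, b1)) = beta (i, b1).
  by move=> hi; rewrite /b (ip_comb vu vo) // mem_idx.
pose A b1 := \sum_(p <= i < n) ip X (v (i, b1)) * cj (beta (i, b1)).
have sumA : A true + A false = 0.
  have : ip X b = 0.
    rewrite /X /comb ip_suml big_nat big1 // => j /andP[_ jn].
    by rewrite ipZl ub // mulr0.
  rewrite /b ip_combr sum_idx big_split /= => E.
  by rewrite -[RHS]E /A; congr (_ + _); apply: eq_bigr => i _; rewrite mulrC.
have diffA : A true - A false = ip (S X) b -
    \sum_(k <- idx p n) ((lam k - sgn R k.2) * (ip X (v k) * cj (beta k))).
  have -> : ip (S X) b = \sum_(k <- idx p n) lam k * (ip X (v k) * cj (beta k)).
    rewrite /b ip_combr !big_seq; apply: eq_bigr => k; rewrite mem_idx => hk.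
    by rewrite /X (comb_K I) // mulrC mulrA.
  transitivity (\sum_(k <- idx p n) sgn R k.2 * (ip X (v k) * cj (beta k))); last first.
    by rewrite -sumrB; apply: eq_bigr => k _; ring.
  rewrite sum_idx big_split /= /A -sumrN; congr (_ + _); apply: eq_bigr => i _.
    by rewrite mul1r.
  by rewrite mulN1r.
have A2 : 2 * modulus (A b0) = modulus (A true - A false).
  have -> : 2 * modulus (A b0) = modulus (2%:R * A b0).
    by rewrite normcM modulus_nat.
  move/eqP: sumA; rewrite addr_eq0 => /eqP sumA.
  case: b0.
    by rewrite sumA; congr (modulus _); ring.
  by rewrite sumA -normcN; congr (modulus _); ring.
have SXb : ip (S X) b = \sum_(p <= j < n) c j * a j - ip (S X) o.
  rewrite (@sum_combE _ (fun j => a j - ip (S (u j)) o)) //.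
  rewrite (@sum_combE _ (fun j => ip (S (u j)) o) _ _ o) // -sumrB.
  by apply: eq_bigr => j _; rewrite mulrBr.
have X0 := nrm_ge0 ip X.
have err : modulus (\sum_(k <- idx p n) ((lam k - sgn R k.2) * (ip X (v k) * cj (beta k))))
    <= e * nrm X.
  have cs := cauchy_schwarz_sum (idx p n) predT
    (fun k => (lam k - sgn R k.2) * ip X (v k)) (fun k => cj (beta k)).
  rewrite modulus_le ?mulr_ge0//.
  under eq_bigr do rewrite mulrA.
  apply: (le_trans cs); rewrite exprMn sqr_nrm -[leRHS]mulr1.
  apply: ler_pM; rewrite ?sumr_ge0 // => *; rewrite ?sqm_ge0 //.
    apply: le_trans (ler_wpM2l (sqr_ge0 e) (bessel vu vo X)).
    rewrite mulr_sumr !big_seq; apply: ler_sum => k; rewrite mem_idx => hk.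
    rewrite sqmM ler_wpM2r ?sqm_ge0 // -modulus_le //.
    by apply: le_trans (heps _ hk); apply: (inv_lam I); case/andP: hk.
  apply: le_trans hb; rewrite /b (N2_comb vu vo).
  by under eq_bigr do rewrite sqmJ.
have hZo : modulus (\sum_(p <= i < n) ip X (v (i, b0)) * cj (ip o (v (i, b0)))) <= q * nrm X.
  rewrite modulus_le ?mulr_ge0//.
  apply: (le_trans (cauchy_schwarz_sum _ _ _ _)); rewrite exprMn sqr_nrm mulrC.
  have half h : \sum_(p <= i < n) sqm (ip h (v (i, b0))) <= N2 h.
    apply: le_trans (bessel vu vo h); rewrite sum_idx; apply: ler_sum => i _.
    by case: (b0); rewrite ?lerDl ?lerDr sqm_ge0.
  apply: ler_pM; rewrite ?sumr_ge0 // => *; rewrite ?sqm_ge0 //.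
  by apply: le_trans hq; under eq_bigr do rewrite sqmJ.
have -> : \sum_(p <= i < n) ip X (v (i, b0)) * cj (ip (o + b) (v (i, b0))) =
   \sum_(p <= i < n) ip X (v (i, b0)) * cj (ip o (v (i, b0))) + A b0.
  rewrite /A -big_split /= !big_nat; apply: eq_bigr => i hi.
  by rewrite ipDl bv // rmorphD mulrDr.
apply: (le_trans (ler_wpM2l _ (le_normcD _ _))) => //.
rewrite mulrDr A2 diffA SXb.
have hSo : modulus (ip (S X) o) <= M * q * nrm X.
  apply: (le_trans (modulus_ip _ _ _)).
  rewrite mulrAC; apply: ler_pM; rewrite ?nrm_ge0// ?nrm_S//.
  by rewrite nrm_le.
have h3 : modulus (\sum_(p <= j < n) c j * a j - ip (S X) o -
    \sum_(k <- idx p n) ((lam k - sgn R k.2) * (ip X (v k) * cj (beta k)))) <=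
    \sum_(p <= j < n) modulus (c j) * modulus (a j) + M * q * nrm X + e * nrm X.
  apply: (le_trans (le_normcD _ _)); rewrite normcN; apply: lerD => //.
  apply: (le_trans (le_normcD _ _)); rewrite normcN; apply: lerD => //.
  apply: (le_trans (modulus_sum _ _ _)); apply: ler_sum => j _.
  by rewrite normcM.
apply: (le_trans (lerD (ler_wpM2l _ hZo) h3)) => //.
rewrite le_eqVlt; apply/orP; left; apply/eqP; ring.
Qed.

End RowStep.

(** * Adding one row *)

Section RowInvariant.
Variables (R : realType) (V : lmodType R[i]) (ip : {dot V for @Num.conj R[i]}).
Variables (S : {linear V -> V}) (y : nat -> V) (eps : nat -> R).

Lemma inv_ext (u u' : nat -> V) (v v' : nat * bool -> V) n p w rho :
  (forall j, (j < n)%N -> u j = u' j) -> (forall k, (k.1 < n)%N -> v k = v' k) ->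
  inv ip S y eps u v n p w rho -> inv ip S y eps u' v' n p w rho.
Proof.
move=> Eu Ev I; have pn := inv_pn I.
have Ec q m c : (m <= n)%N -> comb u' q m c = comb u q m c.
  move=> mn; rewrite /comb !big_nat; apply: eq_bigr => j /andP[_ jm].
  by rewrite Eu // (leq_trans jm).
split=> //.
- by move=> i j hi hj; rewrite -!Eu //; exact: (inv_u I).
- by move=> k l hk hl; rewrite -!Ev //; exact: (inv_v I).
- by move=> k l hk hl; rewrite -!Ev //; exact: (inv_Sv I).
- by move=> k hk; rewrite /lam -!Ev //; exact: (inv_lam I).
- move=> k hk j jk; rewrite -Ev // -Eu ?(ltn_trans jk hk) //.
  exact: (inv_fresh I).
- by move=> k hk t; rewrite -Ev //; exact: (inv_y I).
- move=> j hj k hk; have kn : (k.1 < n)%N by case/andP: hk.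
  by rewrite /lam -Eu // -Ev //; exact: (inv_K I).
- by move=> k hk; rewrite -Eu // -Ev //; exact: (inv_nz I).
- move=> b c; rewrite Ec //; apply: le_trans (inv_star I b c) _.
  rewrite le_eqVlt big_nat [X in _ == X]big_nat; apply/orP; left; apply/eqP.
  by apply: eq_bigr => i /andP[_ hi]; rewrite Ev.
- move=> c; rewrite Ec //; apply: le_trans (inv_gold I c) _.
  rewrite lerD2l lerN2 !big_nat; apply: ler_sum => l /andP[_ hl].
  by rewrite Eu.
Qed.

Lemma inv_weaken u v n p w w' rho rho' :
  (forall j, (p <= j < n)%N -> w' j <= w j) -> rho' <= rho ->
  inv ip S y eps u v n p w rho -> inv ip S y eps u v n p w' rho'.
Proof.
move=> hw hr [h1 h2 h3 h4 h5 h6 h7 h8 h9 h10 h11]; split=> //.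
  move=> b c; apply: le_trans (h10 b c); rewrite !big_nat; apply: ler_sum => j hj.
  by rewrite ler_wpM2r ?sqm_ge0 ?hw.
move=> c; apply: le_trans (h11 c); rewrite ler_wpM2r //.
by apply: sumr_ge0 => *; exact: sqm_ge0.
Qed.

Variables (u : nat -> V) (v : nat * bool -> V) (n p : nat) (w : nat -> R) (rho : R).
Hypothesis I : inv ip S y eps u v n p w rho.
Local Notation lam := (lam ip S v).
Local Notation comb := (comb u).
Local Notation N2 := (N2 ip).
Local Notation nrm := (nrm ip).

Hypothesis vn_orth : forall b b', ip (v (n, b)) (v (n, b')) = (b == b')%:R.
Hypothesis vn_S : forall b b', b != b' -> ip (S (v (n, b))) (v (n, b')) = 0.
Hypothesis vn_lam : forall b, modulus (lam (n, b) - sgn R b) <= eps n.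
Hypothesis vn_u : forall b j, (j < n)%N -> [/\ ip (u j) (v (n, b)) = 0,
  ip (S (u j)) (v (n, b)) = 0 & ip (S (S (u j))) (v (n, b)) = 0].
Hypothesis vn_y : forall b t, (t <= n)%N ->
  ip (y t) (v (n, b)) = 0 /\ ip (S (y t)) (v (n, b)) = 0.
Hypothesis vn_v : forall b k, (k.1 < n)%N -> [/\ ip (v k) (v (n, b)) = 0,
  ip (S (v k)) (v (n, b)) = 0 & ip (S (v (n, b))) (v k) = 0].

Variables (o : V) (beta : nat * bool -> R[i]) (t : R).
Let b := \sum_(k <- idx p n) beta k *: v k.
Let f := v (n, true) + v (n, false).

Hypothesis o_u : forall j, (j < n)%N -> ip (u j) o = 0.
Hypothesis o_diag : forall k, (p <= k.1 < n)%N -> ip (S o) (v k) = lam k * ip o (v k).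
Hypothesis o_vn : forall b1, ip o (v (n, b1)) = 0 /\ ip (S o) (v (n, b1)) = 0.
Hypothesis b_u : forall j, (j < n)%N -> ip (u j) b = 0.
Hypothesis t_gt0 : 0 < t.
Hypothesis t_norm : N2 (o + b) + t ^+ 2 * 2 = 1.
Hypothesis un : u n = o + b + t%:C *: f.

Let vn_f b1 : ip f (v (n, b1)) = 1.
Proof. by rewrite /f ipDl !vn_orth; case: b1; rewrite ?addr0 ?add0r. Qed.

Let b_vn b1 : ip b (v (n, b1)) = 0 /\ ip (S b) (v (n, b1)) = 0.
Proof.
rewrite /b linear_sum !ip_suml !big_seq; split; apply: big1 => k;
  rewrite mem_idx => /andP[_ kn]; have [E1 E2 _] := vn_v b1 kn.
  by rewrite ipZl E1 mulr0.
by rewrite linearZ /= ipZl E2 mulr0.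
Qed.

Let f_v k : (k.1 < n)%N -> ip f (v k) = 0 /\ ip (S f) (v k) = 0.
Proof.
move=> kn; have [E1 _ E2] := vn_v true kn; have [E3 _ E4] := vn_v false kn.
rewrite /f linearD !ipDl E2 E4 !(ipC ip _ (v k)) E1 E3.
by rewrite !addr0 conjc0 addr0.
Qed.

Let un_v k : (k.1 < n)%N -> ip (u n) (v k) = ip (o + b) (v k).
Proof. by move=> kn; rewrite un ipDl ipZl (f_v kn).1 mulr0 addr0. Qed.

Let un_vn b1 : ip (u n) (v (n, b1)) = t%:C.
Proof.
by rewrite un ipDl ipZl vn_f mulr1 ipDl (o_vn b1).1 (b_vn b1).1 !add0r.
Qed.

Lemma ip_row h : (forall k, (p <= k.1 < n)%N -> ip h (v k) = 0) ->
  (forall b1, ip h (v (n, b1)) = 0) -> ip h (u n) = ip h o.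
Proof.
move=> h1 h2; rewrite un !ipDr ipZr /f ipDr !h2 addr0 mulr0 addr0.
rewrite /b ip_combr big_seq big1 ?addr0 // => k; rewrite mem_idx => hk.
by rewrite h1 // mulr0.
Qed.

Lemma ip_row_old j : (j < p)%N -> ip (S (u j)) (u n) = ip (S (u j)) o.
Proof.
move=> jp; have pn := inv_pn I; apply: ip_row.
  move=> k /andP[pk kn].
  by have [_ -> _] := inv_fresh I kn (leq_trans jp pk).
by move=> b1; have [_ -> _] := vn_u b1 (leq_trans jp pn).
Qed.

Lemma ip_row_new j : (j < n)%N -> ip (S (u j)) (u n) = ip (S (u j)) o + ip (S (u j)) b.
Proof.
move=> jn; rewrite un !ipDr ipZr /f ipDr.
have [_ -> _] := vn_u true jn; have [_ -> _] := vn_u false jn.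
by rewrite addr0 mulr0 addr0.
Qed.

Variables (M q e : R) (a : nat -> R[i]).
Hypothesis M0 : 0 <= M.
Hypothesis S_bound : forall x, N2 (S x) <= M ^+ 2 * N2 x.
Hypothesis q0 : 0 <= q.
Hypothesis e0 : 0 <= e.
Hypothesis o_q : N2 o <= q ^+ 2.
Hypothesis b_1 : N2 b <= 1.
Hypothesis t_ge : 15 / 32 <= t ^+ 2.
Hypothesis eps_le : forall i, (p <= i < n)%N -> eps i <= e.
Hypothesis b_S : forall j, (p <= j < n)%N -> ip (S (u j)) b = a j - ip (S (u j)) o.
Hypothesis a_le : \sum_(p <= j < n) modulus (a j) <= 100^-1.
Hypothesis rho0 : 0 <= rho.
Let r := (M + 2) * q + e.
Hypothesis r_le : r <= 10^-1.

(** The loss of weight comes from [cross_bound]. The new column can start with [2 / 5], since this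
    is less than [15 / 32 - 1 / 200 - 1 / 20]. As to [inv_gold], the image of an old combination
    meets only the part [o] of [u n], so at most the fraction [q ^+ 2] of its squared distance is
    lost. *)
Lemma row_inv : inv ip S y eps u v n.+1 p
  (fun j => if j == n then 2 / 5 else w j - (modulus (a j) + r) / 2)
  (rho * (1 - q ^+ 2)).
Proof.
have pn := inv_pn I.
have r0 : 0 <= r by rewrite addr_ge0 // mulr_ge0 // addr_ge0.
have un_u j : (j < n)%N -> ip (u j) (u n) = 0.
  move=> jn; rewrite un !ipDr ipZr /f ipDr o_u // b_u //.
  have [-> _ _] := vn_u true jn; have [-> _ _] := vn_u false jn.
  by rewrite !addr0 mulr0 addr0.
have unn : ip (u n) (u n) = 1.
  have N2f : N2 f = 2 by rewrite /f N2D /N2 !vn_orth /=; lra.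
  rewrite ipxx un N2D_orth.
    by rewrite N2Z sqmR N2f t_norm.
  rewrite ipZr /f ipDr !ipDl (o_vn true).1 (o_vn false).1 (b_vn true).1 (b_vn false).1.
  by rewrite !addr0 mulr0.
have split_lt m : (m < n.+1)%N -> m = n \/ (m < n)%N.
  by rewrite ltnS leq_eqVlt => /predU1P[]; [left|right].
split.
- exact: leqW.
- move=> i j /split_lt[->|hi] /split_lt[->|hj].
  + by rewrite unn eqxx.
  + by rewrite ipC un_u // conjc0 gtn_eqF.
  + by rewrite un_u // ltn_eqF.
  + exact: (inv_u I).
- move=> [i b1] [j b2] /= /split_lt[->|hi] /split_lt[->|hj].
  + by rewrite vn_orth; congr (_%:R); rewrite xpair_eqE eqxx.
  + have [E _ _] := @vn_v b1 (j, b2) hj.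
    by rewrite ipC E conjc0 xpair_eqE gtn_eqF.
  + have [E _ _] := @vn_v b2 (i, b1) hi.
    by rewrite E xpair_eqE ltn_eqF.
  + exact: (inv_v I).
- move=> [i b1] [j b2] /= /split_lt[->|hi] /split_lt[->|hj].
  + by rewrite xpair_eqE eqxx => /vn_S.
  + by have [_ _ ->] := @vn_v b1 (j, b2) hj.
  + by have [_ -> _] := @vn_v b2 (i, b1) hi.
  + exact: (inv_Sv I).
- move=> [i b1] /= /split_lt[->|hi]; first exact: vn_lam.
  exact: (inv_lam I (k := (i, b1))).
- move=> [i b1] /= /split_lt[->|hi] j hj; first exact: vn_u.
  exact: (inv_fresh I (k := (i, b1))).
- move=> [i b1] /= /split_lt[->|hi] j hj; first exact: vn_y.
  exact: (inv_y I (k := (i, b1))).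
- move=> j /split_lt[->|hj] [i b1] /= /andP[pi /split_lt[E|hi]].
  + have Sf : ip (S f) (v (n, b1)) = lam (n, b1).
      rewrite /f linearD ipDl /lam; case: (b1).
        by rewrite (@vn_S false true) // addr0.
      by rewrite (@vn_S true false) // add0r.
    rewrite E un_vn un linearD [S (o + b)]linearD linearZ /= !ipDl ipZl Sf.
    by rewrite (o_vn b1).2 (b_vn b1).2 !add0r mulrC.
  + have kn : ((i, b1).1 < n)%N by [].
    rewrite un_v // un linearD [S (o + b)]linearD linearZ /= !ipDl ipZl (f_v kn).2 mulr0 addr0.
    rewrite o_diag /= ?pi // mulrDr; congr (_ + _).
    rewrite /b linear_sum !ip_suml mulr_sumr !big_seq; apply: eq_bigr => k.
    rewrite mem_idx => /andP[_ hk]; rewrite linearZ /= !ipZl mulrCA; congr (_ * _).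
    have [->|ne] := eqVneq k (i, b1).
      by rewrite (inv_v I) // eqxx mulr1.
    by rewrite (inv_Sv I) // (inv_v I) // (negbTE ne) mulr0.
  + by rewrite E; have [-> -> _] := vn_u b1 hj; rewrite mulr0.
  + by apply: (inv_K I) => //=; rewrite pi.
- move=> [i b1] /= /split_lt[->|hi]; last exact: (inv_nz I (k := (i, b1))).
  by rewrite un_vn fmorph_eq0 gt_eqF.
- move=> b1 c; rewrite big_nat_recr // [leRHS]big_nat_recr //= eqxx.
  have -> : comb p n.+1 c = comb p n c + c n *: u n by rewrite /comb big_nat_recr.
  set X := comb p n c.
  have XN : N2 X = \sum_(p <= j < n) sqm (c j) by rewrite (N2_combE I).
  have Xvn : ip X (v (n, b1)) = 0.
    rewrite /X /comb ip_suml big_nat big1 // => j /andP[_ jn].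
    by have [E _ _] := vn_u b1 jn; rewrite ipZl E mulr0.
  rewrite ipDl Xvn add0r ipZl un_vn sqmM sqmR.
  set Z := \sum_(p <= i < n) ip X (v (i, b1)) * cj (ip (o + b) (v (i, b1))).
  have hZ := cross_bound I M0 S_bound q0 b1 c o_q b_1 e0 eps_le b_u b_S.
  rewrite -/X -/Z -/r in hZ.
  (* The squares of the coordinates of [c n *: u n] along earlier fresh vectors are discarded; only
     the mixed term can be negative. *)
  have low : \sum_(p <= i < n) sqm (ip X (v (i, b1))) - 2 * (modulus (c n) * modulus Z) <=
      \sum_(p <= i < n) sqm (ip (X + c n *: u n) (v (i, b1))).
    apply: (@le_trans _ _ (\sum_(p <= i < n) sqm (ip X (v (i, b1))) +
        2 * complex.Re (cj (c n) * Z))).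
      rewrite lerD2l lerNl -mulrN -ReN; rewrite ler_pM2l //.
      apply: (le_trans (Re_le_modulus _)); rewrite normcN normcM.
      by rewrite modulusJ.
    rewrite /Z mulr_sumr Re_sum mulr_sumr -big_split /= !big_nat; apply: ler_sum => i /andP[_ hi].
    rewrite [ip (X + _) _]ipDl ipZl un_v // sqmD rmorphM mulrCA.
    rewrite -addrA [sqm (c n * _) + _]addrC addrA lerDl; exact: sqm_ge0.
  have star := inv_star I b1 c; rewrite -/X in star.
  have cn0 := modulus_ge0 (c n); have X0 := nrm_ge0 ip X.
  (* Arithmetic-geometric mean in each product of [modulus (c n)] with [modulus (c j)] or [nrm X];
     [200^-1] is half of the bound on the row sum. *)
  have Zb : 2 * (modulus (c n) * modulus Z) <= \sum_(p <= j < n) modulus (a j) / 2 * sqm (c j)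
     + 200^-1 * sqm (c n) + r / 2 * (N2 X + sqm (c n)).
    apply: (@le_trans _ _ (modulus (c n) *
      (\sum_(p <= j < n) modulus (c j) * modulus (a j) + r * nrm X))).
      by rewrite mulrCA ler_wpM2l.
    rewrite mulrDr; apply: lerD.
      rewrite mulr_sumr.
      apply: (@le_trans _ _ (\sum_(p <= j < n)
        (modulus (a j) / 2 * sqm (c j) + modulus (a j) / 2 * sqm (c n)))).
        apply: ler_sum => j _; rewrite -!sqr_modulus.
        have := mulr_ge0 (modulus_ge0 (a j)) (sqr_ge0 (modulus (c j) - modulus (c n))).
        rewrite sqrrB; lra.
      rewrite big_split /= lerD2l -mulr_suml.
      apply: ler_wpM2r; first exact: sqm_ge0.
      rewrite -mulr_suml; move: a_le; set aa := \sum_(_ <= _ < _) _.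
      lra.
    rewrite -sqr_nrm -sqr_modulus.
    have := mulr_ge0 r0 (sqr_ge0 (nrm X - modulus (c n))); rewrite sqrrB; lra.
  have wE : \sum_(p <= i < n)
      (if i == n then 2 / 5 else w i - (modulus (a i) + r) / 2) * sqm (c i) =
    \sum_(p <= j < n) w j * sqm (c j) -
      \sum_(p <= j < n) modulus (a j) / 2 * sqm (c j) - r / 2 * N2 X.
    rewrite XN mulr_sumr -!sumrB !big_nat; apply: eq_bigr => j /andP[_ jn].
    by rewrite ltn_eqF //; ring.
  rewrite wE.
  have cc := sqm_ge0 (c n).
  have t2 : 15 / 32 * sqm (c n) <= sqm (c n) * t ^+ 2 by rewrite mulrC ler_wpM2l.
  have r2 : r * sqm (c n) <= 10^-1 * sqm (c n) by rewrite ler_wpM2r.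
  move: low star Zb t2 r2; set A1 := \sum_(_ <= _ < _) sqm (ip X _).
  set A2 := \sum_(_ <= _ < _) sqm (ip (X + _) _).
  set A3 := \sum_(_ <= _ < _) w _ * _; set A4 := \sum_(_ <= _ < _) _ / 2 * _.
  set tt := sqm (c n) * t ^+ 2; set zz := modulus (c n) * modulus Z.
  set rr := r / 2 * _; set rs := r * sqm (c n); rewrite /rr mulrDr.
  have -> : r / 2 * sqm (c n) = rs / 2 by rewrite /rs; ring.
  set rx := r / 2 * N2 X.
  move: cc; set cc := sqm (c n); lra.
- move=> c; rewrite big_nat_recr //= opprD addrA.
  set x := S (comb 0 p c).
  have -> : ip x (u n) = ip (x - \sum_(0 <= l < n) ip x (u l) *: u l) o.
    rewrite ipBl ip_suml [X in _ - X]big_nat big1 ?subr0; last first.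
      by move=> l /andP[_ ln]; rewrite ipZl o_u // mulr0.
    rewrite /x !(@sum_combE _ _ ip S u c (fun j => ip (S (u j)) o)) // => j /andP[_ jp].
    exact: ip_row_old.
  have cs := cauchy_schwarz ip (x - \sum_(0 <= l < n) ip x (u l) *: u l) o.
  have g := inv_gold I c; rewrite -/x in g.
  have E := N2_proj (iota_uniq _ _) (u_orth I (q := 0)) x.
  rewrite E in cs.
  move: g cs; set D := _ - _; set sq := sqm _; set ss := \sum_(0 <= j < p) _ => g cs.
  have ss0 : 0 <= ss by apply: sumr_ge0 => *; exact: sqm_ge0.
  have D0 : 0 <= D by apply: le_trans g; rewrite mulr_ge0.
  have cs' : sq <= D * q ^+ 2 by apply: (le_trans cs); rewrite ler_wpM2l.
  have q1 : 0 <= 1 - q ^+ 2.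
    have : (M + 2) * q <= 10^-1 by apply: le_trans r_le; rewrite lerDl.
    have := mulr_ge0 M0 q0 => h1 h2; have q2 : q <= 1 by lra.
    by rewrite subr_ge0 expr_le1.
  rewrite mulrAC; apply: (le_trans (ler_wpM2r q1 g)).
  by rewrite mulrBr mulr1 lerD2l lerN2.
Qed.

End RowInvariant.

(** * Turning recent columns into old ones *)

Section Switch.
Variables (R : realType) (V : lmodType R[i]) (ip : {dot V for @Num.conj R[i]}).
Variables (S : {linear V -> V}) (y : nat -> V) (eps : nat -> R).
Variables (u : nat -> V) (v : nat * bool -> V) (n p : nat) (w : nat -> R) (rho : R).
Hypothesis I : inv ip S y eps u v n p w rho.
Hypothesis w_ge : forall j, (p <= j < n)%N -> 4^-1 <= w j.
Hypothesis eps_le : forall i, (p <= i < n)%N -> eps i <= 100^-1.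
Variable M : R.
Hypothesis S_bound : forall x, N2 ip (S x) <= M ^+ 2 * N2 ip x.
Local Notation comb := (comb u).

(* Schur complement: the coefficient of the dropped vector [u q] is chosen so
   that the coordinate along [v (q, b)] vanishes. *)
Lemma star_drop b q : (p <= q <= n)%N -> forall c,
  \sum_(q <= j < n) w j * sqm (c j) <=
    \sum_(q <= i < n) sqm (ip (comb q n c) (v (i, b))).
Proof.
elim: q => [|q IH] /andP[pq qn] c.
  by move: pq; rewrite leqn0 => /eqP <-; exact: (inv_star I).
move: pq; rewrite leq_eqVlt => /predU1P[<-|pq]; first exact: (inv_star I).
pose X := comb q.+1 n c.
pose z := - (ip X (v (q, b)) / ip (u q) (v (q, b))).
pose c' j := if j == q then z else c j.
have Ec : comb q n c' = z *: u q + X.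
  rewrite /comb big_ltn // /c' eqxx; congr (_ + _).
  by rewrite /X /comb; apply: eq_big_nat => j /andP[qj _]; rewrite gtn_eqF.
have := IH _ c'; rewrite -ltnS pq ltnW // => /(_ isT).
rewrite Ec big_ltn // [leRHS]big_ltn // ipDl ipZl /z mulNr divfK; last first.
  exact: (inv_nz I (k := (q, b))).
rewrite addNr sqm0 add0r => h.
apply: le_trans (le_trans _ h) _.
  rewrite -[leLHS]add0r; apply: lerD.
    rewrite mulr_ge0 ?sqm_ge0 // (le_trans _ (w_ge _)) ?invr_ge0 //.
    by rewrite -ltnS pq.
  rewrite !big_nat; apply: ler_sum => j /andP[qj _].
  by rewrite /c' gtn_eqF.
rewrite le_eqVlt; apply/orP; left; apply/eqP.
apply: eq_big_nat => i /andP[qi ni].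
by have [E _ _] := inv_fresh I (k := (i, b)) ni qi; rewrite ipDl ipZl E mulr0 add0r.
Qed.

(* The constant of [inv_gold] that survives when [p] is raised. *)
Definition phi (x : R) := ((2 + 10 * M ^+ 2) / x + 5)^-1.

(** Testing [S x] against the [b] of [row_solve] whose values on [[p, p')] are the conjugate
    coefficients bounds these coefficients by [5] times the squared distance [D]. Subtracting their
    part leaves the older ones to the previous [inv_gold], at the price of the factor
    [2 + 10 * M ^+ 2]. *)
Lemma inv_raise p' : (p <= p' <= n)%N -> 0 < rho ->
  inv ip S y eps u v n p' w (phi rho).
Proof.
move=> /andP[pp' p'n] rho0.
split=> //; [exact: (inv_u I) | exact: (inv_v I) | exact: (inv_Sv I)
  | exact: (inv_lam I) | exact: (inv_fresh I) | exact: (inv_y I) | |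
  exact: (inv_nz I) | |].
- by move=> j jn k /andP[pk kn]; apply: (inv_K I) => //; rewrite (leq_trans pp').
- by move=> b c; apply: star_drop; rewrite pp'.
move=> c.
pose x := comb 0 p' c; pose xo := comb 0 p c; pose xs := comb p p' c.
have xE : x = xo + xs by rewrite /x /comb (big_cat_nat (n := p)).
pose l j := if (j < p')%N then cj (c j) else 0.
have [beta] := row_solve I w_ge eps_le l; cbv zeta.
set b := \sum_(k <- _) _ => -[b1 b2 b3 b4].
pose m := \sum_(p <= j < p') sqm (c j).
have m0 : 0 <= m by apply: sumr_ge0 => *; exact: sqm_ge0.
have ml : \sum_(p <= j < n) sqm (l j) = m.
  have Z : \sum_(p' <= j < n) sqm (l j) = 0.
    by rewrite big_nat big1 // => j /andP[hj _]; rewrite /l ltnNge hj sqm0.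
  rewrite (big_cat_nat (n := p')) //= Z addr0.
  by apply: eq_big_nat => j /andP[_ hj]; rewrite /l hj sqmJ.
have Sxb : ip (S x) b = m%:C.
  rewrite xE linearD ipDl (@sum_combE _ _ ip S u c (fun=> 0)); last first.
    by move=> j /andP[_ jp]; exact: b3.
  rewrite big1 ?add0r; last by move=> *; rewrite mulr0.
  rewrite (@sum_combE _ _ ip S u c l); last first.
    by move=> j /andP[pj jp']; apply: b2; rewrite pj (leq_trans jp').
  rewrite /m rmorph_sum /= !big_nat; apply: eq_bigr => j /andP[_ hj].
  by rewrite /l hj mulJ.
pose pr h := h - \sum_(0 <= l < n) ip h (u l) *: u l.
have prD h h' : pr (h + h') = pr h + pr h'.
  rewrite /pr addrACA -opprD -big_split /=; congr (_ - _).
  by apply: eq_bigr => j _; rewrite ipDl scalerDl.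
have uo := u_orth I (q := 0).
have N2pr h : N2 ip (pr h) = N2 ip h - \sum_(0 <= l < n) sqm (ip h (u l)).
  exact: N2_proj (iota_uniq _ _) uo h.
have hb : ip (pr (S x)) b = m%:C.
  rewrite /pr ipBl Sxb ip_suml big_nat big1 ?subr0 // => j /andP[_ jn].
  by rewrite ipZl b1 // mulr0.
set D := N2 ip (pr (S x)).
have D0 : 0 <= D by exact: N2_ge0.
have mD : m <= 5 * D.
  have := cauchy_schwarz ip (pr (S x)) b; rewrite hb sqmR -/D => cs.
  rewrite ml in b4; have h := le_trans cs (ler_wpM2l D0 b4).
  move: m0; rewrite le_eqVlt => /predU1P[<-|mp]; first by rewrite mulr_ge0.
  by rewrite -(ler_pM2r mp) -expr2; apply: (le_trans h); rewrite mulrCA mulrA.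
have oD : rho * (\sum_(0 <= j < p) sqm (c j)) <= (2 + 10 * M ^+ 2) * D.
  apply: (le_trans (inv_gold I c)); rewrite -/xo -N2pr.
  have -> : pr (S xo) = pr (S x) + - pr (S xs).
    by rewrite xE linearD prD addrK.
  apply: (le_trans (N2D_le _ _ _)); rewrite N2N -/D [(2 + _) * D]mulrDl lerD2l.
  have h1 : N2 ip (pr (S xs)) <= M ^+ 2 * m.
    apply: (@le_trans _ _ (N2 ip (S xs))).
      by rewrite N2pr lerBlDr lerDl; apply: sumr_ge0 => *; exact: sqm_ge0.
    by apply: (le_trans (S_bound _)); rewrite (N2_combE I).
  have h2 := ler_wpM2l (sqr_ge0 M) mD; lra.
rewrite -/x -N2pr -/D.
have -> : \sum_(0 <= j < p') sqm (c j) = \sum_(0 <= j < p) sqm (c j) + m.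
  by rewrite (big_cat_nat (n := p)).
set so := \sum_(0 <= j < p) _ in oD *.
have phi0 : 0 < (2 + 10 * M ^+ 2) / rho + 5.
  by rewrite addr_gt0 // divr_gt0 // ltr_pwDl // mulr_ge0 // sqr_ge0.
rewrite /phi ler_pdivrMl // mulrDl; apply: lerD => //.
by rewrite mulrAC ler_pdivlMr // mulrC.
Qed.

End Switch.

(** * Existence of the next row *)

Section RowExists.
Variables (R : realType) (V : lmodType R[i]) (ip : {dot V for @Num.conj R[i]}).
Variables (S : {linear V -> V}) (y : nat -> V) (eps : nat -> R) (M : R).
Hypothesis M0 : 0 <= M.
Hypothesis S_bound : forall x, N2 ip (S x) <= M ^+ 2 * N2 ip x.

Definition fresh_vectors := forall (hs gs : seq V) (d : R) (b : bool), 0 < d ->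
  exists x, [/\ ip x x = 1, forall h, h \in hs -> ip x h = 0,
    forall g, g \in gs -> ip (S x) g = 0 & modulus (ip (S x) x - sgn R b) <= d].

Hypothesis fresh : fresh_vectors.

(** The second vector is chosen after the first, orthogonal to [x] and [S x] and with image
    orthogonal to [x]; this makes [S] diagonal on the pair. *)
Lemma fresh_pair (hs gs : seq V) (d : R) : 0 < d ->
  exists x : bool -> V, [/\ forall b b', ip (x b) (x b') = (b == b')%:R,
    forall b b', b != b' -> ip (S (x b)) (x b') = 0,
    forall b, modulus (ip (S (x b)) (x b) - sgn R b) <= d,
    forall b h, h \in hs -> ip (x b) h = 0 &
    forall b g, g \in gs -> ip (S (x b)) g = 0].
Proof.
move=> d0; have [x [x1 x2 x3 x4]] := fresh hs gs true d0.
have [z [z1 z2 z3 z4]] := fresh (x :: S x :: hs) (x :: gs) false d0.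
have zx : ip z x = 0 by rewrite z2 // !inE eqxx.
have zSx : ip z (S x) = 0 by rewrite z2 // !inE eqxx orbT.
have Szx : ip (S z) x = 0 by rewrite z3 // !inE eqxx.
exists (fun b => if b then x else z); split.
- by move=> [] []; rewrite ?x1 ?z1 ?zx // ipC zx conjc0.
- by move=> [] [] // _; rewrite ipC zSx conjc0.
- by case.
- by move=> [] h hh; [exact: x2 | apply: z2; rewrite !inE hh !orbT].
- by move=> [] g hg; [exact: x3 | apply: z3; rewrite !inE hg !orbT].
Qed.

Variables (u : nat -> V) (v : nat * bool -> V) (n p : nat) (w : nat -> R) (rho : R).
Hypothesis I : inv ip S y eps u v n p w rho.
Hypothesis w_ge : forall j, (p <= j < n)%N -> 4^-1 <= w j.
Variables (o : V) (q e : R) (a : nat -> R[i]).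
Hypothesis eps_le : forall i, (p <= i < n)%N -> eps i <= e.
Hypothesis e_le : 0 <= e <= 100^-1.
Hypothesis eps_n : 0 < eps n.
Hypothesis rho0 : 0 <= rho.
Hypothesis q0 : 0 <= q.
Hypothesis q_le : (M + 2) * q <= 50^-1.
Hypothesis o_u : forall j, (j < n)%N -> ip (u j) o = 0.
Hypothesis o_diag : diag_on ip S v n p o.
Hypothesis o_q : N2 ip o <= q ^+ 2.
Hypothesis a_le : \sum_(p <= j < n) modulus (a j) <= 100^-1.

Lemma row_exists : exists (un : V) (vn : bool -> V),
  let u' k := if k == n then un else u k in
  let v' k := if k.1 == n then vn k.2 else v k in
  [/\ inv ip S y eps u' v' n.+1 p
        (fun j => if j == n then 2 / 5 else w j - (modulus (a j) + ((M + 2) * q + e)) / 2)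
        (rho * (1 - q ^+ 2)),
      forall j, (p <= j < n)%N -> ip (S (u j)) un = a j,
      forall j, (j < p)%N -> ip (S (u j)) un = ip (S (u j)) o &
      forall t, (t <= p)%N -> ip (y t) un = ip (y t) o].
Proof.
have pn := inv_pn I.
pose vs := [seq v k | k <- idx 0 n].
(* All that [inv] demands of the new fresh vectors, apart from [lam], is orthogonality to finitely
   many vectors: those in [hs], and for their images those in [vs]. *)
pose hs := [:: o; S o] ++ [seq u j | j <- iota 0 n] ++ [seq S (u j) | j <- iota 0 n] ++
  [seq S (S (u j)) | j <- iota 0 n] ++ [seq y t | t <- iota 0 n.+1] ++
  [seq S (y t) | t <- iota 0 n.+1] ++ vs ++ [seq S (v k) | k <- idx 0 n].
have [vn [n1 n2 n3 n4 n5]] := fresh_pair hs vs eps_n.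
have n4' b h : h \in hs -> ip h (vn b) = 0 by move=> hh; rewrite ipC n4 // conjc0.
have memu j : (j < n)%N -> [/\ u j \in hs, S (u j) \in hs & S (S (u j)) \in hs].
  move=> jn; have jm : j \in iota 0 n by rewrite mem_iota.
  by rewrite !mem_cat !(map_f u jm) !(map_f (fun j => S (u j)) jm)
    !(map_f (fun j => S (S (u j))) jm) !orbT.
have memy t : (t <= n)%N -> y t \in hs /\ S (y t) \in hs.
  move=> tn; have jm : t \in iota 0 n.+1 by rewrite mem_iota.
  by rewrite !mem_cat !(map_f y jm) !(map_f (fun j => S (y j)) jm) !orbT.
have memv k : (k.1 < n)%N -> [/\ v k \in hs, S (v k) \in hs & v k \in vs].
  move=> kn; have jm : k \in idx 0 n by rewrite mem_idx.
  by rewrite !mem_cat !(map_f v jm) !(map_f (fun j => S (v j)) jm) !orbT.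
have eps_le' i : (p <= i < n)%N -> eps i <= 100^-1.
  by move=> hi; apply: le_trans (eps_le hi) _; case/andP: e_le.
(* [o] disturbs the recent columns as well, and [b] compensates for it. *)
have [beta] := row_solve I w_ge eps_le' (fun j => a j - ip (S (u j)) o); cbv zeta.
set b := \sum_(k <- _) _ => -[b1 b2 b3 b4].
have Mq := mulr_ge0 M0 q0.
have Q0 := q0; have q_le1 : M * q + 2 * q <= 50^-1 by rewrite -mulrDl.
have Mq_le : M * q <= 50^-1 by lra.
have q_le' : q <= 100^-1 by lra.
have a2 : \sum_(p <= j < n) sqm (a j) <= 100^-1 ^+ 2.
  apply: (@le_trans _ _ (\sum_(p <= j < n) 100^-1 * modulus (a j))).
    rewrite big_nat [leRHS]big_nat; apply: ler_sum => j hj; rewrite -sqr_modulus expr2.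
    apply: ler_wpM2r; first exact: modulus_ge0.
    apply: le_trans a_le; rewrite (bigD1_seq j) ?iota_uniq ?mem_index_iota //=.
    by rewrite lerDl; apply: sumr_ge0 => *; exact: modulus_ge0.
  by rewrite -mulr_sumr expr2 ler_wpM2l // invr_ge0.
have d2 : \sum_(p <= j < n) sqm (ip (S (u j)) o) <= 50^-1 ^+ 2.
  apply: (le_trans (dual_bessel I S_bound o)).
  apply: (le_trans (ler_wpM2l (sqr_ge0 M) o_q)); rewrite -exprMn.
  by rewrite lerXn2r // nnegrE ?invr_ge0.
(* The bound is [5 * (2 / 100 ^ 2 + 2 / 50 ^ 2)]. *)
have Nb : N2 ip b <= 200^-1.
  apply: (le_trans b4).
  have : \sum_(p <= j < n) sqm (a j - ip (S (u j)) o) <=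
      2 * (\sum_(p <= j < n) sqm (a j)) + 2 * \sum_(p <= j < n) sqm (ip (S (u j)) o).
    rewrite !mulr_sumr -big_split /=; apply: ler_sum => j _.
    by apply: (le_trans (sqmD_le _ _)); rewrite sqmN.
  move: a2 d2; set s1 := \sum_(_ <= _ < _) sqm (a _).
  set s2 := \sum_(_ <= _ < _) sqm (ip _ _); set s3 := \sum_(_ <= _ < _) _; lra.
have No : N2 ip o <= 100^-1 ^+ 2.
  by apply: (le_trans o_q); rewrite lerXn2r // nnegrE ?invr_ge0.
have Nob : N2 ip (o + b) <= 1 / 16.
  by apply: (le_trans (N2D_le _ _ _)); lra.
(* This makes [un] a unit vector, as [vn true + vn false] has squared norm [2] and is orthogonal to
   [o + b]. The bound [1 / 16] becomes [15 / 32] for [t ^+ 2]. *)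
pose t := Num.sqrt ((1 - N2 ip (o + b)) / 2).
have t2 : t ^+ 2 = (1 - N2 ip (o + b)) / 2 by rewrite sqr_sqrtr; lra.
have t0 : 0 < t by rewrite sqrtr_gt0; lra.
pose un := o + b + t%:C *: (vn true + vn false).
exists un, vn; cbv zeta.
pose u' k := if k == n then un else u k.
pose v' k := if k.1 == n then vn k.2 else v k.
have Eu j : (j < n)%N -> u j = u' j by move=> jn; rewrite /u' ltn_eqF.
have Ev k : (k.1 < n)%N -> v k = v' k by move=> kn; rewrite /v' ltn_eqF.
have I' : inv ip S y eps u' v' n p w rho by exact: inv_ext I.
have v'n b0 : v' (n, b0) = vn b0 by rewrite /v' eqxx.
have u'n : u' n = un by rewrite /u' eqxx.
have bE : b = \sum_(k <- idx p n) beta k *: v' k.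
  rewrite /b !big_seq; apply: eq_bigr => k; rewrite mem_idx => /andP[_ kn].
  by rewrite Ev.
have vn_orth c c' : ip (v' (n, c)) (v' (n, c')) = (c == c')%:R by rewrite !v'n.
have vn_S c c' : c != c' -> ip (S (v' (n, c))) (v' (n, c')) = 0.
  by rewrite !v'n; exact: n2.
have vn_lam c : modulus (lam ip S v' (n, c) - sgn R c) <= eps n by rewrite /lam !v'n.
have vn_u c j : (j < n)%N -> [/\ ip (u' j) (v' (n, c)) = 0,
   ip (S (u' j)) (v' (n, c)) = 0 & ip (S (S (u' j))) (v' (n, c)) = 0].
  by move=> jn; rewrite v'n -Eu //; have [m1 m2 m3] := memu _ jn; split; apply: n4'.
have vn_y c s : (s <= n)%N -> ip (y s) (v' (n, c)) = 0 /\ ip (S (y s)) (v' (n, c)) = 0.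
  by move=> sn; rewrite v'n; have [m1 m2] := memy _ sn; split; apply: n4'.
have vn_v c k : (k.1 < n)%N -> [/\ ip (v' k) (v' (n, c)) = 0,
    ip (S (v' k)) (v' (n, c)) = 0 & ip (S (v' (n, c))) (v' k) = 0].
  move=> kn; rewrite v'n -Ev //; have [m1 m2 m3] := memv _ kn.
  by split; [apply: n4' | apply: n4' | apply: n5].
have o_vn c : ip o (v' (n, c)) = 0 /\ ip (S o) (v' (n, c)) = 0.
  by rewrite v'n; split; apply: n4'; rewrite !inE eqxx ?orbT.
have o_u' j : (j < n)%N -> ip (u' j) o = 0 by move=> jn; rewrite -Eu //; exact: o_u.
have o_diag' k : (p <= k.1 < n)%N -> ip (S o) (v' k) = lam ip S v' k * ip o (v' k).
  move=> hk; have kn : (k.1 < n)%N by case/andP: hk.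
  by rewrite /lam -Ev //; exact: o_diag.
have b_u j : (j < n)%N -> ip (u' j) (\sum_(k <- idx p n) beta k *: v' k) = 0.
  by move=> jn; rewrite -bE -Eu // b1.
have b_S j : (p <= j < n)%N -> ip (S (u' j)) (\sum_(k <- idx p n) beta k *: v' k) =
    a j - ip (S (u' j)) o.
  by move=> hj; rewrite -bE -Eu ?b2 //; case/andP: hj.
have un' : u' n = o + \sum_(k <- idx p n) beta k *: v' k +
    t%:C *: (v' (n, true) + v' (n, false)) by rewrite u'n -bE !v'n.
have t_norm : N2 ip (o + \sum_(k <- idx p n) beta k *: v' k) + t ^+ 2 * 2 = 1.
  by rewrite -bE t2; lra.
have Nb1 : N2 ip (\sum_(k <- idx p n) beta k *: v' k) <= 1.
  by rewrite -bE; apply: (le_trans Nb); rewrite invf_le1 ?ler1n.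
case/andP: e_le => e0 e1.
split.
- apply: (row_inv I' vn_orth vn_S vn_lam vn_u vn_y vn_v o_u' o_diag' o_vn b_u
    t0 t_norm un' M0 S_bound q0 e0 o_q Nb1 _ eps_le b_S a_le rho0).
    by rewrite t2; lra.
  lra.
- move=> j hj; have jn : (j < n)%N by case/andP: hj.
  by rewrite Eu // -u'n (ip_row_new vn_u un') // b_S // addrC subrK.
- move=> j jp; have jn := leq_trans jp pn.
  by rewrite Eu // -u'n (ip_row_old I' vn_u un').
- move=> s sp; rewrite -u'n (ip_row un') //.
    move=> k /andP[pk kn]; exact: (inv_y I' kn (leq_trans sp pk)).1.
  by move=> c; exact: (vn_y c s (leq_trans sp pn)).1.
Qed.

End RowExists.

(** * The recursive construction *)

(** Dependent choice for a sequence whose next term must fit all the previous ones. [P n] sees the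
    first [n] terms only, so the diagonal of the successive approximations inherits every [P n]. *)
Lemma dependent_build (T : Type) (t0 : T) (P : nat -> (nat -> T) -> Prop) :
  (forall n f g, (forall i, (i < n)%N -> f i = g i) -> P n f -> P n g) ->
  P 0 (fun=> t0) ->
  (forall n f, P n f -> exists t, P n.+1 (fun k => if k == n then t else f k)) ->
  exists f, forall n, P n f.
Proof.
move=> ext P0 step.
have [F hF] : {F : nat * (nat -> T) -> T & forall nf, P nf.1 nf.2 ->
    P nf.1.+1 (fun k => if k == nf.1 then F nf else nf.2 k)}.
  apply: (@choice _ _ (fun (nf : nat * (nat -> T)) t => P nf.1 nf.2 ->
    P nf.1.+1 (fun k => if k == nf.1 then t else nf.2 k))) => -[n f] /=.
  have [/step[t ht]|np] := pselect (P n f); first by exists t.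
  by exists t0.
pose g := fix g n : nat -> T := if n is m.+1 then
  fun k => if k == m then F (m, g m) else g m k else fun=> t0.
have gP n : P n (g n) by elim: n => // n IH; exact: (hF (n, g n)).
have gE n k : (k < n)%N -> g n k = g k.+1 k.
  elim: n => // n IH; rewrite ltnS leq_eqVlt => /predU1P[->//|kn].
  by rewrite /= ltn_eqF // IH //= eqxx.
exists (fun k => g k.+1 k) => n; apply: ext (gP n) => i hi; exact: gE.
Qed.

Section Construction.
Variables (R : realType) (V : lmodType R[i]) (ip : {dot V for @Num.conj R[i]}).
Variables (S : {linear V -> V}) (y : nat -> V) (M : R).
Hypothesis M0 : 0 <= M.
Hypothesis S_bound : forall x, N2 ip (S x) <= M ^+ 2 * N2 ip x.
Hypothesis fresh : fresh_vectors ip S.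
Variables (B : nat -> nat -> Prop) (A : nat -> nat -> R[i]).
Hypothesis row_sum : forall n p, \sum_(p <= j < n) modulus (A n j) <= 100^-1.
Hypothesis col_sum : forall j n, \sum_(j.+1 <= k < n) modulus (A k j) <= 100^-1.
Variables (base : nat -> nat) (rho q e eps : nat -> R) (tgt : nat -> option nat) (s : R).
Local Notation cost k := ((M + 2) * q k + e k).
Hypothesis base0 : base 0 = 0%N.
Hypothesis baseS : forall n, (base n <= base n.+1 <= n.+1)%N.
Hypothesis rho_gt0 : forall n, 0 < rho n.
Hypothesis q_bound : forall n, 0 <= q n /\ (M + 2) * q n <= 50^-1.
Hypothesis row_normal : forall n, tgt n = None ->
  \sum_(0 <= j < base n) sqm (A n j) <= rho n * q n ^+ 2.
Hypothesis row_target : forall n t, tgt n = Some t ->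
  [/\ (t <= base n)%N, forall j, (j < base n)%N -> ~ B n j & q n = s].
Hypothesis rho_step : forall n, rho n.+1 <= rho n * (1 - q n ^+ 2).
Hypothesis rho_switch : forall n, base n.+1 != base n ->
  rho n.+1 <= phi M (rho n * (1 - q n ^+ 2)).
Hypothesis cost_sum : forall n j, (base n <= j)%N ->
  \sum_(j.+1 <= k < n.+1) cost k <= 5^-1.
Hypothesis eps_bound : forall n, 0 < eps n <= 100^-1.
Hypothesis e_bound : forall n, 0 <= e n <= 100^-1.
Hypothesis eps_e : forall n i, (base n <= i < n)%N -> eps i <= e n.

(** The weights of [inv_star] after [n] rows, with the losses of [row_inv] added up. *)
Let w n j : R := 2 / 5 - \sum_(j.+1 <= k < n) (modulus (A k j) + cost k) / 2.

(** For orthonormal [u], the squared distance from [h] to the span of the first [n] terms. *)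
Let dist2 (u : nat -> V) n h := N2 ip h - \sum_(0 <= l < n) sqm (ip h (u l)).

Let cost_ge0 k : 0 <= cost k.
Proof.
have [q0 _] := q_bound k; have /andP[e0 _] := e_bound k.
by rewrite addr_ge0 // mulr_ge0 // addr_ge0.
Qed.

(** The loss is at most [(1 / 100 + 1 / 5) / 2]. The case [m = n.+1] serves the moment after row
    [n], when the base is about to be raised. *)
Let w_ge n m j : (n <= m <= n.+1)%N -> (base n <= j)%N -> 4^-1 <= w m j.
Proof.
move=> nm bj; rewrite /w -mulr_suml big_split /=.
have h1 := col_sum j m.
have h2 : \sum_(j.+1 <= k < m) cost k <= 5^-1.
  apply: le_trans (cost_sum bj).
  have [->|ne] := eqVneq m n.+1; first by [].
  have -> : m = n by apply/eqP; rewrite eqn_leq -ltnS ltn_neqAle ne; case/andP: nm => -> ->.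
  have [nj|jn] := leqP n j.+1.
    by rewrite big_geq //; apply: sumr_ge0 => *; exact: cost_ge0.
  by rewrite [leRHS]big_nat_recr //= ?lerDl // ltnW.
move: h1 h2; set s1 := \sum_(_ <= _ < _) modulus _; set s2 := \sum_(_ <= _ < _) _; lra.
Qed.

Lemma choose_o u v n : inv ip S y eps u v n (base n) (w n) (rho n) -> exists o : V,
  [/\ forall j, (j < n)%N -> ip (u j) o = 0, diag_on ip S v n (base n) o,
    N2 ip o <= q n ^+ 2,
    tgt n = None -> forall j, (j < base n)%N -> ip (S (u j)) o = A n j
  & forall t, tgt n = Some t -> sqm (ip (y t) o) = s ^+ 2 * dist2 u n (y t)].
Proof.
move=> I; case E : (tgt n) => [t|].
  have [tb _ qs] := row_target E.
  pose z := y t - \sum_(0 <= l < n) ip (y t) (u l) *: u l.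
  have uo := u_orth I (q := 0).
  have zN : N2 ip z = dist2 u n (y t) := N2_proj (iota_uniq _ _) uo _.
  have uz j : (j < n)%N -> ip (u j) z = 0.
    move=> jn; rewrite ipC (proj_orth (iota_uniq _ _) uo) ?conjc0 //.
    by rewrite mem_index_iota.
  (* As [t <= base n], the recent fresh vectors see neither [y t] nor its image. *)
  have zd : diag_on ip S v n (base n) z.
    apply: diag_onB.
      by move=> k /andP[bk kn]; have [-> ->] := inv_y I kn (leq_trans tb bk); rewrite mulr0.
    by apply: diag_on_sum => j /andP[_ jn]; exact: (inv_K I).
  have yz : ip (y t) z = (N2 ip z)%:C.
    have yE : y t = z + \sum_(0 <= l < n) ip (y t) (u l) *: u l by rewrite subrK.
    rewrite {1}yE ipDl ipxx ip_suml big_nat big1 ?addr0 // => j /andP[_ jn].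
    by rewrite ipZl uz // mulr0.
  (* This gives [o] the length [s]. If [z = 0], the quotient is [0] by convention, and there is no
     distance left to reduce. *)
  pose c : R := s / Num.sqrt (N2 ip z).
  have cN : c ^+ 2 * N2 ip z <= q n ^+ 2 /\ (c * N2 ip z) ^+ 2 = s ^+ 2 * N2 ip z.
    rewrite /c qs; have := N2_ge0 ip z; rewrite le_eqVlt => /predU1P[<-|z0].
      by rewrite !mulr0 expr0n /= sqr_ge0.
    have s0 : Num.sqrt (N2 ip z) != 0 by rewrite gt_eqF // sqrtr_gt0.
    have zE : N2 ip z = Num.sqrt (N2 ip z) ^+ 2 by rewrite sqr_sqrtr // ltW.
    by rewrite !exprMn exprVn -zE divfK ?gt_eqF //; split=> //; rewrite expr2 mulrA divfK // gt_eqF.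
  exists (c%:C *: z); split=> //.
  - by move=> j jn; rewrite ipZr uz // mulr0.
  - exact: diag_onZ.
  - by rewrite N2Z sqmR cN.1.
  - move=> t' [<-]; rewrite ipZr yz conjc_real -zN -rmorphM /= sqmR; exact: cN.2.
have [z0 [ho1 ho2 ho3 ho4]] := old_solve I (A n) (rho_gt0 n).
exists z0; split=> //.
rewrite -(ler_pM2l (rho_gt0 n)); apply: (le_trans ho4); exact: row_normal.
Qed.

Theorem basis_construction : exists u : nat -> V,
  [/\ forall i j, ip (u i) (u j) = (i == j)%:R,
    forall k j, (j < k)%N -> B k j -> ip (S (u j)) (u k) = A k j
  & forall k t, tgt k = Some t -> dist2 u k.+1 (y t) <= (1 - s ^+ 2) * dist2 u k (y t)].
Proof.
(* Term [k] of the recursion is the triple of [u k], [v (k, true)] and [v (k, false)]. *)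
pose U (f : nat -> V * V * V) k := (f k).1.1.
pose W (f : nat -> V * V * V) (k : nat * bool) := if k.2 then (f k.1).1.2 else (f k.1).2.
pose P n f := [/\ inv ip S y eps (U f) (W f) n (base n) (w n) (rho n),
  forall k j, (k < n)%N -> (j < k)%N -> B k j -> ip (S (U f j)) (U f k) = A k j
  & forall k t, (k < n)%N -> tgt k = Some t ->
     dist2 (U f) k.+1 (y t) <= (1 - s ^+ 2) * dist2 (U f) k (y t)].
have dist_ext u u' n h : (forall j, (j < n)%N -> u j = u' j) -> dist2 u n h = dist2 u' n h.
  by move=> E; congr (_ - _); apply: eq_big_nat => i /andP[_ hi]; rewrite E.
have [|||f hf] := @dependent_build _ (0 : V, 0 : V, 0 : V) P.
- move=> n f g E [h1 h2 h3].
  have EU j : (j < n)%N -> U f j = U g j by move=> jn; rewrite /U E.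
  split.
  + by apply: inv_ext h1 => // k kn; rewrite /W E.
  + by move=> k j kn jk Bkj; rewrite -!EU // ?h2 // (ltn_trans jk).
  + move=> k t kn tk; rewrite -(dist_ext (U f) (U g)); last first.
      by move=> j jk; apply: EU; exact: leq_trans jk kn.
    rewrite -(dist_ext (U f) (U g)); first exact: h3.
    by move=> j jk; apply: EU; exact: ltn_trans jk kn.
- split=> //; rewrite base0; split=> //.
  + by move=> b c; rewrite !big_geq.
  + move=> c; rewrite !big_geq // mulr0 subr0; exact: N2_ge0.
- move=> n f [I h2 h3].
  have [z0 [ho1 ho2 ho3 ho4 ho5]] := choose_o I.
  have [q0 qM] := q_bound n.
  have pn := inv_pn I.
  have wn j : (base n <= j < n)%N -> 4^-1 <= w n j.
    by move=> /andP[bj _]; apply: (@w_ge n n) => //; rewrite leqnn leqnSn.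
  have /andP[en0 _] := eps_bound n.
  have [un [vn []]] := row_exists M0 S_bound fresh I wn (eps_e (n := n)) (e_bound n)
    en0 (ltW (rho_gt0 n)) q0 qM ho1 ho2 ho3 (row_sum n (base n)).
  move=> I' r1 r2 r3.
  exists (un, vn true, vn false).
  set g := fun k => if k == n then _ else f k.
  have gU k : U g k = if k == n then un else U f k by rewrite /U /g; case: ifP.
  have gW k : W g k = if k.1 == n then vn k.2 else W f k.
    by rewrite /W /g; case: k => i [] /=; case: ifP.
  have wS j : (j <= n)%N -> w n.+1 j =
     if j == n then 2 / 5 else w n j - (modulus (A n j) + cost n) / 2.
    rewrite /w leq_eqVlt => /predU1P[->|jn]; first by rewrite eqxx big_geq // subr0.
    by rewrite ltn_eqF // big_nat_recr //= opprD addrA.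
  have J : inv ip S y eps (U g) (W g) n.+1 (base n) (w n.+1) (rho n * (1 - q n ^+ 2)).
    apply: inv_weaken (lexx _) _; last first.
      by apply: inv_ext I' => k _; rewrite ?gU ?gW.
    by move=> j /andP[_]; rewrite ltnS => jn; rewrite wS.
  have Ug j : (j < n)%N -> U g j = U f j by move=> jn; rewrite gU ltn_eqF.
  have Un : U g n = un by rewrite gU eqxx.
  have rho1 : 0 < rho n * (1 - q n ^+ 2) by apply: lt_le_trans (rho_step n).
  split.
  (* Row [n] was built with [base n]; only now do columns become old. *)
  + have [Eb|Nb] := eqVneq (base n.+1) (base n).
      by rewrite Eb; apply: inv_weaken J.
    apply: (inv_weaken (fun j _ => lexx _) (rho_switch Nb)).
    apply: (inv_raise J _ _ S_bound (baseS n) rho1).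
      move=> j /andP[bj _]; apply: (@w_ge n n.+1) => //; by rewrite leqnSn leqnn.
    by move=> i _; case/andP: (eps_bound i).
  + move=> k j; rewrite ltnS leq_eqVlt => /predU1P[->|kn] jk Bkj; last first.
      by rewrite !Ug ?h2 // (ltn_trans jk).
    rewrite Un Ug //; have [jb|bj] := ltnP j (base n); last by rewrite r1 // bj.
    rewrite r2 //; case E : (tgt n) => [t|]; last exact: ho4.
    by have [_ /(_ j jb)] := row_target E.
  + move=> k t; rewrite ltnS leq_eqVlt => /predU1P[->|kn] tk; last first.
      rewrite (dist_ext (U g) (U f)); last by move=> j jk; apply: Ug; exact: leq_trans jk kn.
      rewrite (dist_ext (U g) (U f)); last by move=> j jk; apply: Ug; exact: ltn_trans jk kn.
      exact: h3.
    rewrite (dist_ext (U g) (U f) n) //.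
    have -> : dist2 (U g) n.+1 (y t) = dist2 (U g) n (y t) - sqm (ip (y t) (U g n)).
      by rewrite /dist2 big_nat_recr //= opprD addrA.
    have [tb _ _] := row_target tk.
    by rewrite (dist_ext (U g) (U f) n) // Un r3 // ho5 // mulrBl mul1r.
exists (U f); split.
- move=> i j; have [I _ _] := hf (maxn i j).+1.
  by apply: (inv_u I); rewrite ltnS ?leq_maxl ?leq_maxr.
- by move=> k j jk Bkj; have [_ h _] := hf k.+1; apply: h.
- by move=> k t tk; have [_ _ h] := hf k.+1; apply: h.
Qed.

End Construction.

(** * Choice of the parameters *)

Section Schedule.
Variable R : realType.

Lemma small_tail (f : nat -> R) (b d : R) : (forall k, 0 <= f k) ->
  (forall n, \sum_(0 <= k < n) f k <= b) -> 0 < d ->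
  exists m0, forall m n, (m0 <= m)%N -> \sum_(m <= k < n) f k <= d.
Proof.
move=> f0 fb d0; pose E := [set x | exists n, x = \sum_(0 <= k < n) f k]%classic.
have hE : has_sup E.
  split; first by exists (\sum_(0 <= k < 0) f k); exists 0%N.
  by exists b => _ [n ->]; exact: fb.
have [_ [m0 ->] h] := sup_adherent d0 hE.
exists m0 => m n mm; have [nm|mn] := leqP n m.
  by rewrite big_geq // ltW.
have hn : \sum_(0 <= k < n) f k <= sup E by apply: sup_upper_bound hE _ _; exists n.
rewrite (big_cat_nat (n := m)) //= in hn; last exact: ltnW.
rewrite (big_cat_nat (n := m0)) //= in hn.
have := sumr_ge0 (index_iota m0 m) (P := predT) (F := f) (fun k _ => f0 k).
move: h hn; set s0 := \sum_(0 <= _ < _) _; set s1 := \sum_(m0 <= _ < _) _.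
set s2 := \sum_(m <= _ < _) _; lra.
Qed.

Lemma geometric_sum m n : \sum_(m <= k < n) (2^-1 : R) ^+ k <= 2.
Proof.
have [nm|/ltnW mn] := leqP n m; first by rewrite big_geq.
suff : \sum_(m <= k < n) (2^-1 : R) ^+ k = 2 * (2^-1 ^+ m - 2^-1 ^+ n).
  move=> ->; have h1 : (2^-1 : R) ^+ m <= 1 by apply: exprn_ile1; lra.
  have : 0 <= (2^-1 : R) ^+ n by apply: exprn_ge0; lra.
  lra.
rewrite -(subnKC mn); elim: (n - m)%N => [|d IH].
  by rewrite addn0 big_geq // subrr mulr0.
by rewrite addnS big_nat_recr ?leq_addr //= IH exprS; lra.
Qed.

Variables (M : R) (A : nat -> nat -> R[i]) (B : nat -> nat -> Prop).
Hypothesis M0 : 0 <= M.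
Hypothesis col_sum : forall j m n, \sum_(m <= k < n) modulus (A k j) <= 100^-1.
Hypothesis adm : forall m, exists2 n, (m < n)%N & forall j, (j <= m)%N -> ~ B n j.

Let alpha p k : R := \sum_(0 <= j < p) modulus (A k j).
(** While the constant of [inv_gold] is at least [rho / 2], the length [c rho * alpha p k] suffices
    for an [o] producing the entries of row [k] in the [p] old columns. *)
Let c (rho : R) := Num.sqrt (2 / rho).

Let alpha_ge0 p k : 0 <= alpha p k.
Proof. by apply: sumr_ge0 => *; exact: modulus_ge0. Qed.

Let c_ge0 x : 0 <= c x. Proof. exact: sqrtr_ge0. Qed.

(** Each of the [p] columns contributes at most [1 / 100] to the sum of [alpha p] over all rows. The
    tails therefore beat any constant depending on [p] and [x]. *)
Let alpha_tail p x : exists2 m, (p <= m)%N &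
  forall n, \sum_(m <= k < n) (M + 2) * (c x * alpha p k) <= 100^-1.
Proof.
have [] := @small_tail (fun k => (M + 2) * (c x * alpha p k))
  ((M + 2) * (c x * (p%:R * 100^-1))) 100^-1.
- by move=> k; rewrite !mulr_ge0 // addr_ge0.
- move=> n; rewrite -!mulr_sumr ler_wpM2l ?addr_ge0 // ler_wpM2l // exchange_big /=.
  apply: (@le_trans _ _ (\sum_(0 <= j < p) 100^-1)).
    by apply: ler_sum => j _; exact: col_sum.
  by rewrite sumr_const_nat subn0 mulr_natl.
- by rewrite invr_gt0.
- move=> m0 h; exists (maxn p m0); first exact: leq_maxl.
  by move=> n; apply: h; exact: leq_maxr.
Qed.

Lemma phi_gt0 x : 0 < x -> 0 < phi M x.
Proof.
move=> x0; rewrite /phi invr_gt0 addr_gt0 // divr_gt0 // ltr_pwDl //.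
by rewrite mulr_ge0 // sqr_ge0.
Qed.

Lemma phi_le x z : 0 < x -> x <= z -> phi M x <= phi M z.
Proof.
move=> x0 xz; have z0 := lt_le_trans x0 xz.
have K0 : 0 <= 2 + 10 * M ^+ 2 by rewrite addr_ge0 // mulr_ge0 // sqr_ge0.
rewrite /phi lef_pV2 ?posrE ?ltr_wpDl ?divr_ge0 ?(ltW z0) ?(ltW x0) //.
by rewrite lerD2r ler_wpM2l // lef_pV2 ?posrE.
Qed.

Lemma phi_id x : 0 < x -> phi M x <= x.
Proof.
move=> x0; have K0 : 0 <= 10 * M ^+ 2 by rewrite mulr_ge0 // sqr_ge0.
rewrite /phi invf_ple ?posrE ?ltr_wpDl ?divr_ge0 ?addr_ge0 ?(ltW x0) //.
rewrite mulrDl -addrA -[leLHS]mul1r.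
have xi : 0 < x^-1 by rewrite invr_gt0.
have := mulr_ge0 K0 (ltW xi); lra.
Qed.

(* Rows in [mE e, mE (e + 1)) have the columns [j < pE e] as old ones.  Only row
   [nu e], which has no prescribed entry in an old column, is used to absorb a
   target vector. *)
Lemma eras : exists (mE pE nu : nat -> nat) (rE : nat -> R),
  [/\ mE 0%N = 0%N /\ pE 0%N = 0%N,
      forall e, [/\ (mE e < nu e)%N, (nu e < mE e.+1)%N, pE e.+1 = (nu e).+1,
        (e <= pE e)%N & (pE e <= mE e)%N],
      forall e j, (j <= mE e)%N -> ~ B (nu e) j,
      forall e, 0 < rE e /\ rE e.+1 = phi M (rE e / 2)
    & forall e n, \sum_(mE e <= k < n) (M + 2) * (c (rE e) * alpha (pE e) k) <= 100^-1].
Proof.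
have [nu0 hnu] : {nu0 : nat -> nat & forall m, (m < nu0 m)%N /\
    forall j, (j <= m)%N -> ~ B (nu0 m) j}.
  apply: (@choice _ _ (fun m n => (m < n)%N /\ forall j, (j <= m)%N -> ~ B n j)) => m.
  by have [n h1 h2] := adm m; exists n.
have [mm hmm] : {mm : nat * R -> nat & forall px, (px.1 <= mm px)%N /\
    forall n, \sum_(mm px <= k < n) (M + 2) * (c px.2 * alpha px.1 k) <= 100^-1}.
  apply: (@choice _ _ (fun (px : nat * R) m => (px.1 <= m)%N /\
    forall n, \sum_(m <= k < n) (M + 2) * (c px.2 * alpha px.1 k) <= 100^-1)) => px.
  by have [m h1 h2] := alpha_tail px.1 px.2; exists m.
(* A state holds the start of an era, its number of old columns and its constant for [inv_gold]. The
   start is chosen last, since it depends on the other two. The division by [2] provides for the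
   decrease of the constant during an era. *)
pose step (st : nat * nat * R) := let p := (nu0 st.1.1).+1 in
  let x := phi M (st.2 / 2) in (mm (p, x), p, x).
pose St e := iter e step (0%N, 0%N, 1).
pose mE e := (St e).1.1; pose pE e := (St e).1.2; pose rE e := (St e).2.
pose nu e := nu0 (mE e).
have pm e : (pE e <= mE e)%N.
  by case: e => // e; have [h _] := hmm (pE e.+1, rE e.+1).
have m_nu e : (mE e < nu e)%N by have [h _] := hnu (mE e).
have r0 e : 0 < rE e.
  by elim: e => [|e IH]; [exact: ltr01 | apply: phi_gt0; rewrite divr_gt0].
exists mE, pE, nu, rE; split=> //.
- move=> e; split=> //; first by apply: leq_trans (pm e.+1).
  elim: e => // e IH; apply: (leq_ltn_trans IH).
  by apply: (leq_ltn_trans (pm e)); apply: ltnW; rewrite ltnS.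
- by move=> e; have [_ h] := hnu (mE e).
- case=> [|e] n; last by have [_] := hmm (pE e.+1, rE e.+1); apply.
  rewrite big1 ?invr_ge0 // => k _.
  by rewrite /alpha big_geq // !mulr0.
Qed.

(** As [pE g.+1] is [nu g + 1], a column still recent in era [g + 1] came after row [nu g]. Up to
    then it has paid for at most one target row, at [1 / 1000], and for the tails of two eras, at
    [1 / 100] each; the [e k] add at most [1 / 50]. *)
Lemma schedule : let s := (1000 * (M + 2))^-1 in
  exists (base : nat -> nat) (rho q e eps : nat -> R) (tgt : nat -> option nat),
  [/\ [/\ base 0 = 0%N, forall n, (base n <= base n.+1 <= n.+1)%N,
        forall n, 0 < rho n & forall n, 0 <= q n /\ (M + 2) * q n <= 50^-1],
     (forall n, tgt n = None ->
        \sum_(0 <= j < base n) sqm (A n j) <= rho n * q n ^+ 2) /\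
     (forall n t, tgt n = Some t ->
        [/\ (t <= base n)%N, forall j, (j < base n)%N -> ~ B n j & q n = s]),
     (forall n, rho n.+1 <= rho n * (1 - q n ^+ 2)) /\
     (forall n, base n.+1 != base n -> rho n.+1 <= phi M (rho n * (1 - q n ^+ 2))),
     [/\ forall n j, (base n <= j)%N -> \sum_(j.+1 <= k < n.+1) ((M + 2) * q k + e k) <= 5^-1,
        forall n, 0 < eps n <= 100^-1, forall n, 0 <= e n <= 100^-1
      & forall n i, (base n <= i < n)%N -> eps i <= e n]
   & forall t m, exists2 k, (m <= k)%N & tgt k = Some t].
Proof.
move=> s.
have [mE [pE [nu [rE [[mE0 pE0] hE hB hr hT]]]]] := eras.
have M2 : 0 < M + 2 by rewrite ltr_wpDl.
have s0 : 0 < s by rewrite invr_gt0 (mulr_gt0 _ M2) ?ltr0n.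
have Ms : (M + 2) * s = 1000^-1.
  by rewrite /s invfM mulrCA divff ?mulr1 // gt_eqF.
have mS e : (mE e < mE e.+1)%N by have [h1 h2 _ _ _] := hE e; exact: ltn_trans h2.
have mM e e' : (e <= e')%N -> (mE e <= mE e')%N.
  move=> /subnKC <-; elim: (e' - e)%N => [|d IH]; first by rewrite addn0.
  by rewrite addnS (leq_trans IH) // ltnW.
have me e : (e <= mE e)%N by have [_ _ _ h1 h2] := hE e; exact: leq_trans h2.
have ex n : exists e, (n < mE e.+1)%N by exists n; exact: me n.+1.
pose era n := ex_minn (ex n).
have eraP n : (mE (era n) <= n < mE (era n).+1)%N.
  rewrite /era; case: ex_minnP => -[|e] -> hmin; first by rewrite mE0.
  by rewrite andbT leqNgt; apply/negP => /hmin; rewrite ltnn.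
have eraE e n : (mE e <= n < mE e.+1)%N -> era n = e.
  move=> /andP[h1 h2]; have /andP[h3 h4] := eraP n.
  have [l|l|//] := ltngtP (era n) e.
    by have := leq_ltn_trans (leq_trans (mM _ _ l) h1) h4; rewrite ltnn.
  by have := leq_ltn_trans (leq_trans (mM _ _ l) h3) h2; rewrite ltnn.
have eraS n : era n.+1 = era n \/ (era n.+1 = (era n).+1 /\ n.+1 = mE (era n).+1).
  have /andP[h1 h2] := eraP n; move: h2; rewrite leq_eqVlt => /predU1P[E|h2].
    by right; split=> //; apply: eraE; rewrite E leqnn mS.
  by left; apply: eraE; rewrite h2 andbT ltnW.
pose base n := pE (era n).
pose q n := if n == nu (era n) then s else c (rE (era n)) * alpha (pE (era n)) n.
(* A fresh vector of row [i] is still in use at row [n] only if [i >= base n >= era n]. Then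
   [n < mE i.+1], so [eps i <= e n] however long the eras are. *)
pose e n : R := 2^-1 ^+ n / 100.
pose eps i : R := 2^-1 ^+ mE i.+1 / 100.
(* [logn 2 (e + 1)] takes every value for infinitely many [e]. *)
pose tgt n := if n == nu (era n) then Some (logn 2 (era n).+1) else None.
(* A sum may replace the product of the factors [1 - q k ^+ 2], because
   [(1 - x) * (1 - z) >= 1 - x - z] for nonnegative [x] and [z]. The sum stays below [1 / 2]
   ([Q2]). *)
pose rho n := rE (era n) * (1 - \sum_(mE (era n) <= k < n) q k ^+ 2).
have q0 n : 0 <= q n.
  by rewrite /q; case: ifP => _; [exact: ltW | exact: mulr_ge0].
have Mq0 n : 0 <= (M + 2) * q n by apply: mulr_ge0 => //; exact: ltW.
have tail0 g k : 0 <= (M + 2) * (c (rE g) * alpha (pE g) k).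
  by apply: mulr_ge0; [exact: ltW | exact: mulr_ge0].
have tail_sub g m n : (mE g <= m)%N ->
    \sum_(m <= k < n) (M + 2) * (c (rE g) * alpha (pE g) k) <= 100^-1.
  move=> gm; have [nm|/ltnW mn] := leqP n m; first by rewrite big_geq // invr_ge0.
  apply: le_trans (hT g n); rewrite [leRHS](big_cat_nat (n := m)) //= lerDr.
  by apply: sumr_ge0.
have tailB g m n : (nu g < m)%N -> (n <= mE g.+1)%N ->
    \sum_(m <= k < n) (M + 2) * q k <= 100^-1.
  move=> gm ng; have [h1 _ _ _ _] := hE g.
  apply: le_trans (tail_sub g m n _); last by rewrite ltnW // (ltn_trans h1).
  rewrite le_eqVlt; apply/orP; left; apply/eqP; apply: eq_big_nat => k /andP[mk kn].
  have -> : q k = c (rE g) * alpha (pE g) k; last by [].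
  have E : era k = g.
    by apply: eraE; rewrite (leq_trans kn ng) andbT ltnW // (ltn_trans h1) // (leq_trans gm).
  by rewrite /q E gtn_eqF // (leq_trans gm).
have tailA g m n : (mE g <= m)%N -> (n <= mE g.+1)%N ->
    \sum_(m <= k < n) (M + 2) * q k <= 100^-1 + 1000^-1.
  move=> gm ng.
  apply: (@le_trans _ _ (\sum_(m <= k < n) ((M + 2) * (c (rE g) * alpha (pE g) k) +
      (if k == nu g then 1000^-1 else 0)))).
    rewrite big_nat [leRHS]big_nat; apply: ler_sum => k /andP[mk kn].
    have E : era k = g by apply: eraE; rewrite (leq_trans kn ng) andbT (leq_trans gm).
    by rewrite /q E; case: ifP => _; rewrite ?Ms ?lerDr ?addr0.
  rewrite big_split /=; apply: lerD; first exact: tail_sub.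
  rewrite -big_mkcond big_nat1_eq; case: ifP => _; first exact: lexx.
  by rewrite invr_ge0 ler0n.
have Mq_le n : (M + 2) * q n <= 100^-1 + 1000^-1.
  have /andP[h1 h2] := eraP n.
  by have := tailA _ _ _ h1 h2; rewrite big_nat1.
have q1 n : q n <= 100^-1.
  have := Mq_le n; have := mulr_ge0 M0 (q0 n); have := q0 n.
  rewrite mulrDl; lra.
have Q2 g n : (n <= mE g.+1)%N -> \sum_(mE g <= k < n) q k ^+ 2 <= 2^-1.
  move=> ng; apply: (@le_trans _ _ (\sum_(mE g <= k < n) (M + 2) * q k)).
    apply: ler_sum => k _; rewrite expr2 ler_wpM2r //; have := q1 k; have := M0; lra.
  apply: (le_trans (tailA _ _ _ (leqnn _) ng)); lra.
exists base, rho, q, e, eps, tgt.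
have rE0 g : 0 < rE g by have [] := hr g.
have rho_ge n : rE (era n) / 2 <= rho n.
  rewrite /rho ler_pM2l //; have /andP[_ h2] := eraP n.
  have := Q2 (era n) n (ltnW h2); lra.
have rho1 n : rE (era n) / 2 <= rho n * (1 - q n ^+ 2).
  rewrite /rho -mulrA ler_pM2l //; have /andP[h1 h2] := eraP n.
  have := Q2 (era n) n.+1 h2; rewrite big_nat_recr //=.
  have := sumr_ge0 (index_iota (mE (era n)) n) (P := predT) (F := fun k => q k ^+ 2)
    (fun k _ => sqr_ge0 _).
  have := sqr_ge0 (q n); set z := q n ^+ 2; set t := \sum_(_ <= _ < _) _ => z0 t0 h.
  have := mulr_ge0 t0 z0; nra.
have rho_gt0 n : 0 < rho n by apply: lt_le_trans (rho_ge n); rewrite divr_gt0.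
have pS g : (pE g <= pE g.+1)%N.
  have [h1 _ -> _ h3] := hE g.
  by apply: (leq_trans h3); rewrite ltnW // ltnW.
split.
- split=> //.
  + by rewrite /base (eraE 0%N) // mE0 /=; have := mS 0%N; rewrite mE0.
  + move=> n; have /andP[h1 h2] := eraP n; rewrite /base; have [->|[-> ->]] := eraS n.
      by rewrite leqnn /=; have [_ _ _ _ h3] := hE (era n); rewrite (leq_trans h3) // leqW.
    by rewrite pS; have [_ _ _ _ h3] := hE (era n).+1.
  + by move=> n; split=> //; apply: (le_trans (Mq_le n)); lra.
- split.
  + move=> n; rewrite /tgt; case: eqP => // /eqP ne _.
    apply: (@le_trans _ _ (alpha (base n) n ^+ 2)).
      rewrite expr2 {2}/alpha mulr_sumr !big_nat; apply: ler_sum => j hj.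
      rewrite -sqr_modulus expr2 ler_wpM2r ?modulus_ge0 // /alpha.
      rewrite (bigD1_seq j) ?iota_uniq ?mem_index_iota //= lerDl.
      by apply: sumr_ge0 => *; exact: modulus_ge0.
    rewrite /q (negbTE ne) exprMn mulrA -[leLHS]mul1r ler_wpM2r ?sqr_ge0 //.
    rewrite sqr_sqrtr ?divr_ge0 ?(ltW (rE0 _)) //.
    have := ler_wpM2r (_ : 0 <= 2 / rE (era n)) (rho_ge n).
    rewrite divr_ge0 ?(ltW (rE0 _)) // => /(_ isT); apply: le_trans.
    by rewrite -mulrA mulKf ?pnatr_eq0 // mulfV // gt_eqF.
  + move=> n t; rewrite /tgt /q; case: eqP => // E [<-].
    have [h1 h2 h3 h4 h5] := hE (era n); split=> //.
      apply: (leq_trans _ h4); rewrite -ltnS; exact: ltn_logl.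
    by move=> j jb; have := hB _ _ (leq_trans (ltnW jb) h5); rewrite -E.
- have sw n : era n.+1 = (era n).+1 -> n.+1 = mE (era n).+1 -> rho n.+1 = phi M (rE (era n) / 2).
    by move=> E1 E2; rewrite /rho E1 -E2 big_geq // subr0 mulr1; have [_ ->] := hr (era n).
  have half0 n : 0 < rE (era n) / 2 by rewrite divr_gt0.
  split=> n.
  + have [E|[E1 E2]] := eraS n; last first.
      rewrite sw //; apply: (le_trans (phi_id (half0 n))); exact: rho1.
    rewrite /rho E -mulrA ler_pM2l //; have /andP[h1 h2] := eraP n.
    rewrite big_nat_recr //=.
    have := sumr_ge0 (index_iota (mE (era n)) n) (P := predT) (F := fun k => q k ^+ 2)
      (fun k _ => sqr_ge0 _).
    have := sqr_ge0 (q n); set z := q n ^+ 2; set t := \sum_(_ <= _ < _) _ => z0 t0.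
    have := mulr_ge0 t0 z0; nra.
  + move=> nb; have [E|[E1 E2]] := eraS n; first by move: nb; rewrite /base E eqxx.
    by rewrite sw // phi_le.
- split.
  + move=> n j bj; rewrite big_split /=.
    have h1 : \sum_(j.+1 <= k < n.+1) e k <= 50^-1.
      rewrite /e -mulr_suml; have := geometric_sum j.+1 n.+1.
      by set t := \sum_(_ <= _ < _) _; lra.
    have /andP[h2 h3] := eraP n.
    suff : \sum_(j.+1 <= k < n.+1) (M + 2) * q k <= 100^-1 + 100^-1 + 1000^-1.
      by move: h1; set t := \sum_(_ <= _ < _) _; set t' := \sum_(_ <= _ < _) _; lra.
    have [mj|jm] := leqP (mE (era n)) j.+1.
      apply: (le_trans (tailA _ _ _ mj h3)); lra.
    move: bj h2 h3 jm; rewrite /base; case: (era n) => [|g] bj h2 h3 jm.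
      by move: jm; rewrite mE0.
    rewrite (big_cat_nat (n := mE g.+1)) //=; [|exact: ltnW|exact: leqW].
    rewrite -addrA; apply: lerD; last exact: tailA.
    by apply: (tailB g) => //; have [_ _ E _ _] := hE g; apply: leqW; rewrite -E.
  + move=> n; rewrite /eps divr_gt0 ?exprn_gt0 ?invr_gt0 //=.
    rewrite -[leRHS]mul1r ler_pM2r ?invr_gt0 //; apply: exprn_ile1; lra.
  + move=> n; rewrite /e divr_ge0 ?exprn_ge0 ?invr_ge0 //=.
    rewrite -[leRHS]mul1r ler_pM2r ?invr_gt0 //; apply: exprn_ile1; lra.
  + move=> n i /andP[bi _]; rewrite /eps /e ler_wpM2r ?invr_ge0 //.
    apply: ler_wiXn2l; [lra | lra |].
    have /andP[_ h2] := eraP n; apply: (leq_trans (ltnW h2)); apply: mM; rewrite ltnS.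
    by apply: leq_trans bi; have [_ _ _ h _] := hE (era n).
- move=> t m; pose g := (2 ^ t * (m.*2.+1)).-1.
  have gE : g.+1 = (2 ^ t * (m.*2.+1))%N by rewrite prednK // muln_gt0 expn_gt0.
  have [h1 h2 _ _ _] := hE g.
  exists (nu g).
    apply: (@leq_trans g); last by apply: (leq_trans (me g)); exact: ltnW.
    rewrite -ltnS gE; apply: (@leq_trans (m.*2.+1)); first by rewrite ltnS -addnn leq_addr.
    by rewrite leq_pmull // expn_gt0.
  rewrite /tgt (eraE g) ?eqxx; last by rewrite h2 andbT ltnW.
  rewrite gE lognM ?expn_gt0 // pfactorK // lognE /= dvdn2 /= odd_double /=.
  by rewrite addn0.
Qed.

End Schedule.

(** * Vectors from the essential numerical range *)

Section Limits.
Variable R : realType.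
Implicit Types z w : nat -> R[i].

Definition tends z (l : R[i]) := forall d : R, 0 < d ->
  exists N, forall n, (N <= n)%N -> modulus (z n - l) <= d.

Lemma tends_cst l : tends (fun=> l) l.
Proof. by move=> d d0; exists 0%N => n _; rewrite subrr normc0 ltW. Qed.

Lemma tendsD z w l k : tends z l -> tends w k -> tends (fun n => z n + w n) (l + k).
Proof.
move=> hz hw d d0; have d2 : 0 < d / 2 by rewrite divr_gt0.
have [N hN] := hz _ d2; have [N' hN'] := hw _ d2.
exists (maxn N N') => n; rewrite geq_max => /andP[h1 h2].
rewrite opprD addrACA; apply: (le_trans (le_normcD _ _)).
have := hN _ h1; have := hN' _ h2; lra.
Qed.

Lemma tendsZ a z l : tends z l -> tends (fun n => a * z n) (a * l).
Proof.
move=> hz d d0.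
have K1 : 0 < modulus a + 1 by rewrite ltr_wpDl // modulus_ge0.
have [N hN] := hz _ (divr_gt0 d0 K1); exists N => n /hN h.
rewrite -mulrBr normcM.
have h2 : modulus a <= modulus a + 1 by rewrite lerDl.
have := ler_pM (modulus_ge0 _) (modulus_ge0 _) h2 h.
by rewrite mulrCA divff ?mulr1 // gt_eqF.
Qed.

Lemma tendsB z w l k : tends z l -> tends w k -> tends (fun n => z n - w n) (l - k).
Proof.
move=> hz hw; have := tendsD hz (tendsZ (-1) hw).
by rewrite mulN1r; congr tends; apply/funext => n; rewrite mulN1r.
Qed.

Lemma tendsJ z l : tends z l -> tends (fun n => cj (z n)) (cj l).
Proof.
move=> hz d /hz[N hN]; exists N => n /hN.
by rewrite -rmorphB modulusJ.
Qed.

Lemma tends_sub z l (f : nat -> nat) : (forall n, (n <= f n)%N) ->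
  tends z l -> tends (z \o f) l.
Proof. by move=> hf hz d /hz[N hN]; exists N => n Nn; apply: hN; exact: leq_trans (hf n). Qed.

Definition subsequence (f : nat -> nat) := forall n m, (n < m)%N -> (f n < f m)%N.

Lemma subsequence_ge f n : subsequence f -> (n <= f n)%N.
Proof. by move=> hf; elim: n => // n IH; apply: (leq_ltn_trans IH); exact: hf. Qed.

Lemma real_bw (u : nat -> R) (K : R) : (forall n, `|u n| <= K) ->
  exists2 f, subsequence f & exists l : R, tends (fun n => (u (f n))%:C) l%:C.
Proof.
move=> hu; have bu : bounded_fun u.
  by exists K; split; rewrite ?num_real // => x Kx n _ /=; apply: (le_trans (hu n)); exact: ltW.
have [f fi /cvg_ex[/= l fl]] := bolzano_weierstrass bu.
exists f; first by move=> n m nm; rewrite ltnNge -leEnat fi -ltnNge.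
exists l => d d0; have /cvgrPdist_le/(_ _ d0)[N _ hN] := fl.
exists N => n Nn; rewrite -rmorphB modulusR distrC; exact: hN.
Qed.

Lemma complex_bw z (K : R) : (forall n, modulus (z n) <= K) ->
  exists2 f, subsequence f & exists l, tends (z \o f) l.
Proof.
move=> hz.
have [f hf [a ha]] := real_bw (fun n => le_trans (normRe_le_modulus (z n)) (hz n)).
have hIm n : `|complex.Im (z (f n))| <= K.
  apply: le_trans (hz (f n)); rewrite -normrN -ReiNIm.
  apply: (le_trans (normRe_le_modulus _)).
  have -> : z (f n) * 'i%C = 'i%C * z (f n) by rewrite mulrC.
  by rewrite normcM modulusE unlock /= expr0n add0r expr1n sqrtr1 mul1r.
have [g hg [b hb]] := real_bw hIm.
exists (f \o g); first by move=> n m nm; apply: hf; exact: hg.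
exists (a%:C + 'i%C * b%:C).
have ha' := tends_sub (fun n => subsequence_ge n hg) ha.
have := tendsD ha' (tendsZ 'i%C hb); congr tends; apply/funext => n /=.
by rewrite -complexE.
Qed.

End Limits.

(** * Bounded functionals along orthonormal sequences *)

Section Functionals.
Variables (R : realType) (V : lmodType R[i]) (ip : {dot V for @Num.conj R[i]}).

Record bfun (f : V -> R[i]) : Prop := BFun {
  bfunP : forall a x y, f (a *: x + y) = a * f x + f y;
  bfun_bound : exists2 C, 0 <= C & forall x, sqm (f x) <= C * N2 ip x }.

Section BFunTheory.
Variable f : V -> R[i].
Hypothesis hf : bfun f.

Lemma bfun0 : f 0 = 0.
Proof.
have := bfunP hf 1 0 0; rewrite scaler0 addr0 mul1r => h.
by apply: (addrI (f 0)); rewrite addr0 -h.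
Qed.

Lemma bfunZ a x : f (a *: x) = a * f x.
Proof. by have := bfunP hf a x 0; rewrite bfun0 !addr0. Qed.

Lemma bfunD x y : f (x + y) = f x + f y.
Proof. by have := bfunP hf 1 x y; rewrite scale1r mul1r. Qed.

Lemma bfunB x y : f (x - y) = f x - f y.
Proof. by rewrite -scaleN1r bfunD bfunZ mulN1r. Qed.

Lemma bfun_sum (I : Type) (r : seq I) (P : pred I) (F : I -> V) :
  f (\sum_(i <- r | P i) F i) = \sum_(i <- r | P i) f (F i).
Proof. exact: (big_morph f bfunD bfun0). Qed.

End BFunTheory.

Lemma bfun_ip h : bfun (fun x => ip x h).
Proof.
split; first by move=> a x y; rewrite ipDl ipZl.
by exists (N2 ip h); [exact: N2_ge0 | move=> x; rewrite mulrC; exact: cauchy_schwarz].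
Qed.

Definition bounded_by (M : R) (T : V -> V) := forall x, N2 ip (T x) <= M ^+ 2 * N2 ip x.

Lemma bfun_ipS (T : {linear V -> V}) M h : bounded_by M T -> bfun (fun x => ip (T x) h).
Proof.
move=> hT; split; first by move=> a x y; rewrite linearP ipDl ipZl.
exists (M ^+ 2 * N2 ip h); first by rewrite mulr_ge0 ?sqr_ge0 ?N2_ge0.
move=> x; apply: (le_trans (cauchy_schwarz _ _ _)).
by rewrite mulrAC ler_wpM2r // N2_ge0.
Qed.

(** Bessel's inequality by duality: testing [f] on the combination with coefficients conjugate to
    [f (e k)] bounds the sum of the [sqm (f (e k))] by [C]. *)
Lemma orthonormal_null (e : nat -> V) f : (forall i j, ip (e i) (e j) = (i == j)%:R) ->
  bfun f -> tends (f \o e) 0.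
Proof.
move=> he hf; have [C C0 hC] := bfun_bound hf.
have bnd n : \sum_(0 <= k < n) sqm (f (e k)) <= C.
  set s := \sum_(_ <= _ < _) _.
  have s0 : 0 <= s by apply: sumr_ge0 => *; exact: sqm_ge0.
  pose x := \sum_(0 <= k < n) cj (f (e k)) *: e k.
  have fx : f x = s%:C.
    rewrite /x (bfun_sum hf) /s rmorph_sum /=; apply: eq_bigr => k _.
    by rewrite (bfunZ hf) mulrC mulJ.
  have Nx : N2 ip x = s.
    rewrite /x N2_comb ?iota_uniq //.
    by apply: eq_bigr => k _; rewrite sqmJ.
  have := hC x; rewrite fx Nx sqmR.
  move: s0; rewrite le_eqVlt => /predU1P[<- //|s0].
  by rewrite expr2 ler_pM2r.
move=> d d0; have d2 : 0 < d ^+ 2 by rewrite exprn_gt0.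
have [N hN] := small_tail (fun k => sqm_ge0 (f (e k))) bnd d2.
exists N => n Nn; rewrite subr0 modulus_le; last exact: ltW.
by have := hN n n.+1 Nn; rewrite big_nat1.
Qed.

Variables (T : {linear V -> V}) (M : R).
Hypothesis T_bounded : bounded_by M T.
Variable l : R[i].

(* A sequence that is asymptotically as good as an orthonormal one witnessing
   [l], but may be corrected to lie in the kernels of given functionals. *)
Record weak_witness (z : nat -> V) : Prop := WeakWitness {
  ww_null : forall f, bfun f -> tends (f \o z) 0;
  ww_norm : tends (fun n => ip (z n) (z n)) 1;
  ww_lim : tends (fun n => ip (T (z n)) (z n)) l }.

(** All terms are corrected along a multiple of one term [z n0] with [f (z n0) != 0]. The
    coefficients [f (z n)] tend to [0], so the limits survive. As the corrector comes from the
    sequence itself, functionals vanishing on the sequence continue to do so. *)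
Lemma weak_witness_ker z f : weak_witness z -> bfun f -> exists z',
  [/\ weak_witness z', forall n, f (z' n) = 0
    & forall g, bfun g -> (forall n, g (z n) = 0) -> forall n, g (z' n) = 0].
Proof.
move=> [h1 h2 h3] hf.
have [[n0 fn0]|/forallNP all0] := pselect (exists n, f (z n) != 0); last first.
  by exists z; split=> // n; apply/eqP; have := all0 n; case: eqP.
have [v fv hv] : exists2 v, f v = 1 &
    forall g, bfun g -> (forall n, g (z n) = 0) -> g v = 0.
  exists ((f (z n0))^-1 *: z n0); first by rewrite (bfunZ hf) mulVf.
  by move=> g hg g0; rewrite (bfunZ hg) g0 mulr0.
have f0 := h1 _ hf.
have fzJ := tendsJ f0; rewrite conjc0 in fzJ.
have null0 (a b : nat -> R[i]) : tends a 0 -> tends b 0 -> tends (fun n => a n * b n) 0.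
  move=> ha hb d d0.
  have d1 : 0 < Num.sqrt d by rewrite sqrtr_gt0.
  have [N hN] := ha _ d1; have [N' hN'] := hb _ d1.
  exists (maxn N N') => n; rewrite geq_max => /andP[k1 k2].
  have := ler_pM (modulus_ge0 _) (modulus_ge0 _) (hN _ k1) (hN' _ k2).
  rewrite !subr0 normcM => h; apply: (le_trans h).
  by rewrite -expr2 sqr_sqrtr // ltW.
exists (fun n => z n - f (z n) *: v); split.
- split.
  + move=> g hg; have := tendsB (h1 _ hg) (tendsZ (g v) f0).
    rewrite mulr0 subr0; congr tends; apply/funext => n /=.
    by rewrite (bfunB hg) (bfunZ hg) mulrC.
  + have zv := h1 _ (bfun_ip v).
    have vz := tendsJ zv; rewrite conjc0 in vz.
    have := tendsD (tendsB (tendsB h2 (null0 _ _ fzJ zv)) (null0 _ _ f0 vz))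
      (tendsZ (ip v v) (null0 _ _ f0 fzJ)).
    rewrite mulr0 addr0 !subr0; congr tends; apply/funext => n /=.
    rewrite ipBl !ipBr !ipZl !ipZr (ipC ip v (z n)); ring.
  + have Tzv := h1 _ (bfun_ipS v T_bounded).
    have zTv := tendsJ (h1 _ (bfun_ip (T v))); rewrite conjc0 in zTv.
    have := tendsD (tendsB (tendsB h3 (null0 _ _ fzJ Tzv)) (null0 _ _ f0 zTv))
      (tendsZ (ip (T v) v) (null0 _ _ f0 fzJ)).
    rewrite mulr0 addr0 !subr0; congr tends; apply/funext => n /=.
    rewrite [T (_ - _)]linearB [T (_ *: _)]linearZ /= ipBl !ipBr !ipZl !ipZr.
    rewrite (ipC ip (T v) (z n)); ring.
- by move=> n; rewrite (bfunB hf) (bfunZ hf) fv mulr1 subrr.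
- by move=> g hg g0 n; rewrite (bfunB hg) (bfunZ hg) g0 (hv g hg g0) mulr0 subrr.
Qed.

Lemma unit_witness (e : nat -> V) (Phi : seq (V -> R[i])) (d : R) :
  (forall i j, ip (e i) (e j) = (i == j)%:R) ->
  tends (fun n => ip (T (e n)) (e n)) l ->
  (forall i, (i < size Phi)%N -> bfun (nth (fun=> 0) Phi i)) -> 0 < d ->
  exists x, [/\ ip x x = 1, forall i, (i < size Phi)%N -> nth (fun=> 0) Phi i x = 0
    & modulus (ip (T x) x - l) <= d].
Proof.
move=> he hl hPhi d0.
have w0 : weak_witness e.
  split=> //; first by move=> f hf; exact: orthonormal_null.
  by have := tends_cst (1 : R[i]); congr tends; apply/funext => n; rewrite he eqxx.
have [z [[_ h2 h3] hz]] : exists z, weak_witness z /\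
    forall n i, (i < size Phi)%N -> nth (fun=> 0) Phi i (z n) = 0.
  elim: Phi hPhi => [|f Phi IH] hPhi; first by exists e.
  have [z [wz hz]] := IH (fun i => hPhi i.+1).
  have [z' [wz' h1 h2]] := weak_witness_ker wz (hPhi 0%N isT).
  exists z'; split=> // n [|i] hi /=; first exact: h1.
  by apply: h2 => [|m]; [exact: (hPhi i.+1) | exact: hz].
pose m := modulus l; have m0 : 0 <= m := modulus_ge0 l.
(* The first bound keeps [r^-1] below [2]; the second makes the error from [r - 1] times [l] at most
   [d / 4]. *)
have d1 : 0 < Num.min 2^-1 (d / (4 * (m + 1))).
  by rewrite lt_min invr_gt0 ltr0n /= divr_gt0 // mulr_gt0 // ltr_wpDl.
have [N hN] := h2 _ d1; have [N' hN'] := h3 (d / 4) (divr_gt0 d0 (ltr0n _ 4)).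
pose n := maxn N N'; have {hN}a1 := hN n (leq_maxl _ _); have {hN'}a2 := hN' n (leq_maxr _ _).
rewrite ipxx in a1; set x := z n in a1 a2; set r := N2 ip x in a1.
rewrite -[1]/(1%:C) -rmorphB modulusR le_min in a1; case/andP: a1 => a1 a3.
have r2 : 2^-1 <= r by move: a1; rewrite ler_norml; lra.
have r0 : 0 < r by lra.
have s0 : Num.sqrt r != 0 by rewrite gt_eqF // sqrtr_gt0.
pose c := (Num.sqrt r)^-1.
have c2 : sqm c%:C = r^-1 by rewrite sqmR exprVn sqr_sqrtr // ltW.
exists (c%:C *: x); split.
- by rewrite ipxx N2Z c2 mulVf // gt_eqF.
- by move=> i hi; rewrite (bfunZ (hPhi i hi)) hz // mulr0.
- rewrite [T (_ *: _)]linearZ /= ipZl ipZr mulrA mulJ c2.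
  have -> : (r^-1)%:C * ip (T x) x - l = (r^-1)%:C * ((ip (T x) x - l) - (r - 1)%:C * l).
    have lE : l = (r^-1)%:C * (r%:C * l).
      by rewrite mulrA -rmorphM /= mulVf ?gt_eqF // mul1r.
    by rewrite {1}lE rmorphB rmorph1; ring.
  rewrite normcM modulusR gtr0_norm ?invr_gt0 //.
  have e1 : modulus (ip (T x) x - l - (r - 1)%:C * l) <= d / 4 + d / 4.
    apply: (le_trans (le_normcD _ _)); rewrite normcN normcM modulusR; apply: lerD => //.
    apply: (@le_trans _ _ (d / (4 * (m + 1)) * (m + 1))).
      by apply: ler_pM => //; rewrite lerDl.
    rewrite invfM mulrA divfK // gt_eqF // ltr_wpDl //.
  have r3 : r^-1 <= 2 by rewrite -[leRHS]invrK lef_pV2 ?posrE // invr_gt0.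
  have ri : 0 <= r^-1 by rewrite invr_ge0 ltW.
  have := ler_pM ri (modulus_ge0 _) r3 e1; lra.
Qed.

End Functionals.

(** * A nonzero essential value of a noncompact operator *)

Section Witnesses.
Variables (R : realType) (V : lmodType R[i]) (ip : {dot V for @Num.conj R[i]}).
Variables (S : {linear V -> V}) (M : R).
Hypothesis S_bounded : bounded_by ip M S.

Let phi0 : V -> R[i] := fun=> 0.

Definition functionals (hs gs : seq V) : seq (V -> R[i]) :=
  [seq (fun x => ip x h) | h <- hs] ++ [seq (fun x => ip (S x) g) | g <- gs].

Lemma functionals_bfun hs gs i : (i < size (functionals hs gs))%N ->
  bfun ip (nth phi0 (functionals hs gs) i).
Proof.
rewrite size_cat !size_map => hi; rewrite nth_cat size_map; case: ltnP => h.
  by rewrite (nth_map 0) //; exact: bfun_ip.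
rewrite (nth_map 0) ?ltn_subLR //; exact: bfun_ipS S_bounded.
Qed.

Lemma functionals_ker hs gs x :
  (forall i, (i < size (functionals hs gs))%N -> nth phi0 (functionals hs gs) i x = 0) ->
  (forall h, h \in hs -> ip x h = 0) /\ (forall g, g \in gs -> ip (S x) g = 0).
Proof.
move=> hx; split=> [h /(nthP 0)[i hi <-]|g /(nthP 0)[i hi <-]].
  have := hx i; rewrite size_cat !size_map nth_cat size_map hi (nth_map 0) //.
  by apply; exact: ltn_addr.
have := hx (size hs + i)%N; rewrite size_cat !size_map nth_cat size_map.
by rewrite ltn_add2l [(_ + i < _)%N]ltnNge leq_addr /= addKn (nth_map 0) //; apply.
Qed.

Lemma fresh_from_witnesses (e : bool -> nat -> V) :
  (forall b i j, ip (e b i) (e b j) = (i == j)%:R) ->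
  (forall b, tends (fun n => ip (S (e b n)) (e b n)) (sgn R b)) ->
  fresh_vectors ip S.
Proof.
move=> he hl hs gs d b d0.
have [x [x1 x2 x3]] := unit_witness S_bounded (he b) (hl b) (@functionals_bfun hs gs) d0.
by have [h1 h2] := functionals_ker x2; exists x.
Qed.

(** In the induction, either the new functional vanishes on the common kernel of the others, or this
    kernel contains a vector [v1] of value [1], along which the approximation found for the others
    is corrected. *)
Lemma kernel_correction (Phi : seq (V -> R[i])) :
  (forall i, (i < size Phi)%N -> bfun ip (nth phi0 Phi i)) ->
  exists2 C, 0 <= C & forall x, exists2 x',
    (forall i, (i < size Phi)%N -> nth phi0 Phi i x' = 0) &
    N2 ip (x - x') <= C * \sum_(i < size Phi) sqm (nth phi0 Phi i x).
Proof.
elim: Phi => [|f Phi IH] hPhi.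
  by exists 0 => // x; exists x => //; rewrite subrr N20 mul0r.
have [C C0 hC] := IH (fun i => hPhi i.+1).
have hf := hPhi 0%N isT; rewrite /= in hf.
have sum0 x : 0 <= \sum_(i < size Phi) sqm (nth phi0 Phi i x).
  by apply: sumr_ge0 => *; exact: sqm_ge0.
have [[v [fv hv]]|nov] := pselect (exists v, f v <> 0 /\
    forall i, (i < size Phi)%N -> nth phi0 Phi i v = 0); last first.
  exists C => // x; have [x' h1 h2] := hC x; exists x'.
    case=> [|i] hi /=; last exact: h1.
    by apply: contrapT => fx; apply: nov; exists x'.
  apply: (le_trans h2); rewrite ler_wpM2l // big_ord_recl lerDr; exact: sqm_ge0.
have [Cf Cf0 hCf] := bfun_bound hf.
pose v1 := (f v)^-1 *: v; have f0 : f v != 0 by apply/eqP.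
have fv1 : f v1 = 1 by rewrite /v1 (bfunZ hf) mulVf.
have Nv := N2_ge0 ip v1.
exists (2 * C + 4 * N2 ip v1 + 4 * Cf * C * N2 ip v1).
  by rewrite !addr_ge0 // !mulr_ge0.
move=> x; have [x0 h1 h2] := hC x; exists (x0 - f x0 *: v1).
  case=> [|i] hi /=; first by rewrite (bfunB hf) (bfunZ hf) fv1 mulr1 subrr.
  have hg := hPhi i.+1 hi; rewrite /= in hg.
  by rewrite (bfunB hg) /v1 !(bfunZ hg) h1 // hv // !mulr0 subrr.
rewrite opprB addrA addrAC big_ord_recl /=.
set s := \sum_(_ < _) _ in h2 *.
have s0 : 0 <= s by exact: sum0.
have a1 : sqm (f x0) <= 2 * sqm (f x) + 2 * (Cf * (C * s)).
  have -> : f x0 = f x - f (x - x0) by rewrite (bfunB hf); ring.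
  apply: (le_trans (sqmD_le _ _)); rewrite sqmN lerD2l ler_pM2l //.
  by apply: (le_trans (hCf _)); rewrite ler_wpM2l.
have a2 : N2 ip (x - x0 + f x0 *: v1) <= 2 * (C * s) + 2 * (sqm (f x0) * N2 ip v1).
  apply: (le_trans (N2D_le _ _ _)); rewrite N2Z lerD2r; lra.
apply: (le_trans a2).
have a3 := ler_wpM2r Nv a1.
have b1 := sqm_ge0 (f x).
have b2 : 0 <= C * sqm (f x) by exact: mulr_ge0.
have b3 : 0 <= Cf * C * N2 ip v1 * sqm (f x) by rewrite !mulr_ge0.
have b4 : 0 <= N2 ip v1 * s by rewrite mulr_ge0.
have -> : (2 * C + 4 * N2 ip v1 + 4 * Cf * C * N2 ip v1) * (sqm (f x) + s) =
  2 * (C * sqm (f x)) + 2 * (C * s) + 4 * (N2 ip v1 * sqm (f x)) + 4 * (N2 ip v1 * s)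
  + 4 * (Cf * C * N2 ip v1 * sqm (f x)) + 4 * (Cf * C * N2 ip v1 * s) by ring.
have a4 : (2 * sqm (f x) + 2 * (Cf * (C * s))) * N2 ip v1 =
  2 * (N2 ip v1 * sqm (f x)) + 2 * (Cf * C * N2 ip v1 * s) by ring.
clear -a3 a4 b1 b2 b3 b4; rewrite a4 in a3; lra.
Qed.

Lemma common_subsequence (Phi : seq (V -> R[i])) (x : nat -> V) :
  (forall i, (i < size Phi)%N -> bfun ip (nth phi0 Phi i)) ->
  (forall n, N2 ip (x n) <= 1) ->
  exists2 s, subsequence s & forall i, (i < size Phi)%N ->
    exists l, tends (fun n => nth phi0 Phi i (x (s n))) l.
Proof.
move=> + hx; elim: Phi => [|f Phi IH] hPhi; first by exists id.
have [s hs hl] := IH (fun i => hPhi i.+1).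
have hf := hPhi 0%N isT; rewrite /= in hf; have [C C0 hC] := bfun_bound hf.
have bnd n : modulus (f (x (s n))) <= Num.sqrt C.
  rewrite modulus_le ?sqrtr_ge0 // sqr_sqrtr //; apply: (le_trans (hC _)).
  by rewrite -[leRHS]mulr1 ler_wpM2l.
have [g hg [l hl']] := complex_bw bnd.
exists (s \o g); first by move=> n m nm; apply: hs; exact: hg.
case=> [|i] hi /=; first by exists l.
have [k hk] := hl i hi; exists k.
exact: (tends_sub (fun n => subsequence_ge n hg) hk).
Qed.

Lemma eventually_all (P : nat -> nat -> Prop) k :
  (forall i, (i < k)%N -> exists N, forall n, (N <= n)%N -> P i n) ->
  exists N, forall n, (N <= n)%N -> forall i, (i < k)%N -> P i n.
Proof.
elim: k => [|k IH] h; first by exists 0%N.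
have [N hN] := IH (fun i ik => h i (ltnW ik)); have [N' hN'] := h k (ltnSn k).
exists (maxn N N') => n; rewrite geq_max => /andP[h1 h2] i.
by rewrite ltnS leq_eqVlt => /predU1P[->|ik]; [exact: hN' | exact: hN].
Qed.

(** Finitely many functionals converge along a subsequence, so a difference [D] of two late terms is
    almost in their kernel. Moving it there by squared distance at most [mu] gives [9] as
    [2 * 4 + 2 * (1 / 2)], and [d / 4] from [d <= 2 * N2 (S z) + 2 * (d / 4)]. *)
Lemma separated_kernel (x : nat -> V) (d : R) : 0 < d ->
  (forall n, N2 ip (x n) <= 1) ->
  (forall n m, (n < m)%N -> d <= N2 ip (S (x n) - S (x m))) ->
  forall Phi, (forall i, (i < size Phi)%N -> bfun ip (nth phi0 Phi i)) ->
  exists z, [/\ forall i, (i < size Phi)%N -> nth phi0 Phi i z = 0,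
    N2 ip z <= 9 & d / 4 <= N2 ip (S z)].
Proof.
move=> d0 hx sep Phi hPhi.
have [C C0 hC] := kernel_correction hPhi.
have [s hs hl] := common_subsequence hPhi hx.
pose k := size Phi.
have M1 : 0 < M ^+ 2 + 1 by rewrite ltr_wpDl // sqr_ge0.
pose mu := Num.min 2^-1 (d / (4 * (M ^+ 2 + 1))).
have mu0 : 0 < mu by rewrite lt_min invr_gt0 ltr0n /= divr_gt0 // mulr_gt0.
have Ck : 0 < (C + 1) * (k%:R + 1) by rewrite mulr_gt0 // ltr_wpDl.
pose nu := mu / ((C + 1) * (k%:R + 1)).
have nu0 : 0 < nu by rewrite divr_gt0.
have sn0 : 0 < Num.sqrt nu / 2 by rewrite divr_gt0 // sqrtr_gt0.
have [N hN] : exists N, forall n, (N <= n)%N -> forall i, (i < k)%N ->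
    forall m, (N <= m)%N -> sqm (nth phi0 Phi i (x (s n) - x (s m))) <= nu.
  have [|N hN] := @eventually_all (fun i n => exists l,
      modulus (nth phi0 Phi i (x (s n)) - l) <= Num.sqrt nu / 2 /\ forall m, (n <= m)%N ->
      modulus (nth phi0 Phi i (x (s m)) - l) <= Num.sqrt nu / 2) k.
    move=> i ik; have [l /(_ _ sn0)[N hN]] := hl i ik.
    exists N => n Nn; exists l; split; first exact: hN.
    by move=> m nm; apply: hN; exact: leq_trans nm.
  exists N => n Nn i ik m Nm; have [l [_ h]] := hN N (leqnn N) i ik.
  rewrite (bfunB (hPhi i ik)) -[leRHS](sqr_sqrtr (ltW nu0)) -modulus_le ?sqrtr_ge0 //.
  have -> : nth phi0 Phi i (x (s n)) - nth phi0 Phi i (x (s m)) =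
    (nth phi0 Phi i (x (s n)) - l) - (nth phi0 Phi i (x (s m)) - l) by ring.
  apply: (le_trans (le_normcD _ _)); rewrite normcN.
  have := h _ Nn; have := h _ Nm; lra.
pose D := x (s N) - x (s N.+1).
have [z hz1 hz2] := hC D; exists z.
have ND : N2 ip D <= 4.
  apply: (le_trans (N2D_le _ _ _)); rewrite N2N.
  have := hx (s N); have := hx (s N.+1); lra.
have small : N2 ip (D - z) <= mu.
  apply: (le_trans hz2).
  apply: (@le_trans _ _ (C * (\sum_(i < k) nu))).
    rewrite ler_wpM2l //; apply: ler_sum => i _; exact: hN.
  rewrite sumr_const card_ord -mulr_natl.
  apply: (@le_trans _ _ ((C + 1) * ((k%:R + 1) * nu))).
    apply: ler_pM => //; first by rewrite mulr_ge0 // ltW.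
      by rewrite lerDl.
    by apply: ler_wpM2r; [exact: ltW | rewrite lerDl].
  by rewrite mulrA /nu mulrC divfK // gt_eqF.
move: (small); rewrite le_min => /andP[sm1 sm2].
split=> //.
- have -> : z = D + - (D - z) by rewrite opprB addrC subrK.
  apply: (le_trans (N2D_le _ _ _)); rewrite N2N; lra.
- have h1 : d <= 2 * N2 ip (S z) + 2 * N2 ip (S (D - z)).
    apply: (@le_trans _ _ (N2 ip (S z + S (D - z)))); last exact: N2D_le.
    rewrite -linearD addrC subrK /D linearB; apply: sep; exact: hs.
  have h2 : N2 ip (S (D - z)) <= d / 4.
    apply: (le_trans (S_bounded _)).
    apply: (@le_trans _ _ ((M ^+ 2 + 1) * (d / (4 * (M ^+ 2 + 1))))).
      by apply: ler_pM; rewrite ?sqr_ge0 ?N2_ge0 // lerDl.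
    by rewrite le_eqVlt; apply/orP; left; apply/eqP; field; rewrite gt_eqF.
  lra.
Qed.

Lemma polarization (x z : V) : 4%:R * ip (S x) z =
  (ip (S (x + z)) (x + z) - ip (S (x - z)) (x - z)) +
  'i%C * (ip (S (x + 'i%C *: z)) (x + 'i%C *: z) - ip (S (x - 'i%C *: z)) (x - 'i%C *: z)).
Proof.
have ii : 'i%C * cj 'i%C = 1 :> R[i] by rewrite mulJ unlock /= expr0n add0r expr1n.
have i2 : 'i%C * 'i%C = -1 :> R[i] by rewrite -expr2 sqr_i.
rewrite ![S (_ - _)]linearB ![S (_ + _)]linearD ![S (_ *: _)]linearZ /=.
rewrite !ipBl !ipDl !ipBr !ipDr !ipZl !ipZr.
transitivity (2%:R * (ip (S x) z + ip (S z) x) + 2%:R * (('i%C * cj 'i%C) * ip (S x) z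
   + ('i%C * 'i%C) * ip (S z) x)); last by ring.
by rewrite ii i2; ring.
Qed.

Hypothesis M0 : 0 <= M.

(** Polarization expresses [<S x, S x>] through the quadratic values at the four vectors
    [x + a *: S x] with [a] a fourth root of unity, all orthogonal to [G] because [x] and [S x] are.
    Were these values at most [kappa] relative to the squared norms, [N2 (S x)] would be at most
    [kappa * (K * (1 + M ^+ 2)) = D / 2]. *)
Lemma kernel_witness (K D : R) : 0 < K -> 0 < D ->
  (forall Phi, (forall i, (i < size Phi)%N -> bfun ip (nth phi0 Phi i)) ->
    exists z, [/\ forall i, (i < size Phi)%N -> nth phi0 Phi i z = 0,
    N2 ip z <= K & D <= N2 ip (S z)]) ->
  exists2 kappa, 0 < kappa & forall G : seq V, exists z, [/\ ip z z = 1,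
    forall g, g \in G -> ip z g = 0 & kappa <= modulus (ip (S z) z)].
Proof.
move=> K0 D0 H.
have KM : 0 < K * (1 + M ^+ 2) by rewrite mulr_gt0 // ltr_pwDl // sqr_ge0.
pose kappa := D / (2 * (K * (1 + M ^+ 2))).
have k0 : 0 < kappa by rewrite divr_gt0 // mulr_gt0.
exists kappa => // G.
have [x [hx1 hx2 hx3]] := H _ (@functionals_bfun G G).
have [xG wG] := functionals_ker hx1.
pose z := S x.
suff [y [hy1 hy2]] : exists y, kappa * N2 ip y < modulus (ip (S y) y) /\
    forall g, g \in G -> ip y g = 0.
  have y0 : 0 < N2 ip y.
    apply: N2_gt0; apply/eqP => E; move: hy1.
    by rewrite E N20 mulr0 ip0r normc0 ltxx.
  have s0 : sqm ((Num.sqrt (N2 ip y))^-1)%:C = (N2 ip y)^-1.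
    by rewrite sqmR exprVn sqr_sqrtr // ltW.
  exists (((Num.sqrt (N2 ip y))^-1)%:C *: y); split.
  - by rewrite ipxx N2Z s0 mulVf // gt_eqF.
  - by move=> g hg; rewrite ipZl hy2 // mulr0.
  - rewrite [S _]linearZ /= ipZl ipZr mulrA mulJ s0 normcM modulusR gtr0_norm ?invr_gt0 //.
    by rewrite mulrC ler_pdivlMr // ltW.
apply: contrapT => no.
have le y : (forall g, g \in G -> ip y g = 0) -> modulus (ip (S y) y) <= kappa * N2 ip y.
  by move=> hy; rewrite leNgt; apply/negP => h; apply: no; exists y.
have inG a g : g \in G -> ip (x + a *: z) g = 0.
  by move=> hg; rewrite ipDl ipZl xG // wG // mulr0 addr0.
have l1 := le _ (inG 1); have l2 := le _ (inG (-1)).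
have l3 := le _ (inG 'i%C); have l4 := le _ (inG (- 'i%C)).
rewrite ?scaleNr ?scale1r in l1 l2 l3 l4.
have mi : modulus ('i%C : R[i]) = 1.
  by rewrite modulusE unlock /= expr0n add0r expr1n sqrtr1.
have : modulus (4%:R * ip (S x) z) <= kappa * (4 * N2 ip x + 4 * N2 ip z).
  rewrite polarization.
  apply: (le_trans (le_normcD _ _)); rewrite normcM mi mul1r.
  have e1 : modulus (ip (S (x + z)) (x + z) - ip (S (x - z)) (x - z)) <=
      kappa * N2 ip (x + z) + kappa * N2 ip (x - z).
    by apply: (le_trans (le_normcD _ _)); rewrite normcN; exact: lerD.
  have e2 : modulus (ip (S (x + 'i%C *: z)) (x + 'i%C *: z) -
        ip (S (x - 'i%C *: z)) (x - 'i%C *: z)) <=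
      kappa * N2 ip (x + 'i%C *: z) + kappa * N2 ip (x - 'i%C *: z).
    by apply: (le_trans (le_normcD _ _)); rewrite normcN; exact: lerD.
  apply: (le_trans (lerD e1 e2)); rewrite !N2D !N2N !ipNr !ReN N2Z -sqr_modulus mi expr1n.
  rewrite le_eqVlt; apply/orP; left; apply/eqP; ring.
rewrite normcM modulus_nat ipxx modulusR ger0_norm ?N2_ge0 // => h.
have zM : N2 ip z <= M ^+ 2 * K.
  by apply: (le_trans (S_bounded _)); rewrite ler_wpM2l // sqr_ge0.
have h1 : kappa * (N2 ip x + N2 ip z) <= kappa * (K * (1 + M ^+ 2)).
  by rewrite ler_pM2l // mulrDr mulr1; apply: lerD => //; rewrite mulrC.
have h2 : kappa * (K * (1 + M ^+ 2)) = D / 2.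
  move: KM; rewrite /kappa; set kk := K * _ => KM.
  by field; rewrite gt_eqF.
move: hx3 h; rewrite -/z; clear -D0 h1 h2; lra.
Qed.

(** Choosing each witness orthogonal to its predecessors gives an orthonormal sequence whose values
    have modulus at least [kappa]; a subsequence has a limit, necessarily nonzero. *)
Lemma separated_value (x : nat -> V) (d : R) : 0 < d ->
  (forall n, N2 ip (x n) <= 1) ->
  (forall n m, (n < m)%N -> d <= N2 ip (S (x n) - S (x m))) ->
  exists e l, [/\ forall i j, ip (e i) (e j) = (i == j)%:R,
    tends (fun n : nat => ip (S (e n)) (e n)) l & l <> 0].
Proof.
move=> d0 hx sep.
have [] := @kernel_witness 9 (d / 4) _ _ (separated_kernel d0 hx sep).
- by rewrite ltr0n.
- by rewrite divr_gt0.
move=> kappa k0 hk.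
pose P n (f : nat -> V) :=
  (forall i j, (i < n)%N -> (j < n)%N -> ip (f i) (f j) = (i == j)%:R) /\
  (forall i, (i < n)%N -> kappa <= modulus (ip (S (f i)) (f i))).
have [|||f hf] := @dependent_build _ (0 : V) P.
- move=> n f g E [h1 h2]; split=> [i j hi hj|i hi]; rewrite -!E //; [exact: h1 | exact: h2].
- by split.
- move=> n f [h1 h2]; have [z [z1 z2 z3]] := hk [seq f i | i <- iota 0 n].
  have zf i : (i < n)%N -> ip z (f i) = 0.
    by move=> hi; apply: z2; apply: map_f; rewrite mem_iota.
  exists z; set g := fun k => _.
  have gn : g n = z by rewrite /g eqxx.
  have gl i : (i < n)%N -> g i = f i by move=> hi; rewrite /g (ltn_eqF hi).
  have cases i : (i < n.+1)%N -> i = n \/ (i < n)%N.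
    by rewrite ltnS leq_eqVlt => /predU1P[]; [left|right].
  split=> [i j /cases[->|hi] /cases[->|hj]|i /cases[->|hi]].
  + by rewrite gn z1 eqxx.
  + by rewrite gn (gl _ hj) (zf _ hj) (gtn_eqF hj).
  + by rewrite gn (gl _ hi) ipC (zf _ hi) conjc0 (ltn_eqF hi).
  + by rewrite (gl _ hi) (gl _ hj) h1.
  + by rewrite gn.
  + by rewrite (gl _ hi) h2.
have fo i j : ip (f i) (f j) = (i == j)%:R.
  by have [h _] := hf (maxn i j).+1; apply: h; rewrite ltnS ?leq_maxl ?leq_maxr.
have fk i : kappa <= modulus (ip (S (f i)) (f i)).
  by have [_ h] := hf i.+1; exact: h.
have bnd i : modulus (ip (S (f i)) (f i)) <= M.
  rewrite modulus_le //; apply: (le_trans (cauchy_schwarz _ _ _)).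
  have N1 : N2 ip (f i) = 1 by rewrite /N2 fo eqxx.
  by have := S_bounded (f i); rewrite N1 !mulr1.
have [s hs [l hl]] := complex_bw bnd.
exists (f \o s), l; split=> //.
- move=> i j; rewrite /= fo; congr (_%:R); congr nat_of_bool; apply/eqP/eqP => [E|->//].
  have [ij|ji|//] := ltngtP i j; first by have := hs _ _ ij; rewrite E ltnn.
  by have := hs _ _ ji; rewrite E ltnn.
- move=> l0; rewrite l0 in hl; have [N hN] := hl (kappa / 2) (divr_gt0 k0 (ltr0n _ 2)).
  have := hN N (leqnn N); rewrite subr0 /=; have := fk (s N); lra.
Qed.

End Witnesses.

(** * Hilbert spaces *)

Section HilbertNorm.
Variables (R : realType) (H : completeNormedModType R[i]).
Variable ip : {dot H for @Num.conj R[i]}.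
Hypothesis hn : induces_norm ip.

Lemma norm_nrm (x : H) : `|x| = (nrm ip x)%:C.
Proof.
apply/eqP; rewrite -(@eqrXn2 _ 2) //; last by rewrite lecR nrm_ge0.
by rewrite -rmorphXn /= sqr_nrm -ipxx hn.
Qed.

Lemma bounded_operatorP (T : {linear H -> H}) :
  bounded_operator T <-> exists2 M, 0 <= M & bounded_by ip M T.
Proof.
split=> [/linear_boundedP/pinfty_ex_gt0[r r0 hr]|[M M0 hM]].
  have rR : r = (complex.Re r)%:C by rewrite RRe_real // gtr0_real.
  move: r0 hr; rewrite rR ltcR; set M := complex.Re r => M0 hM.
  exists M => [|x]; first exact: ltW.
  have := hM x; rewrite !norm_nrm -rmorphM lecR => h.
  rewrite -!sqr_nrm -exprMn ler_sqr ?nnegrE ?nrm_ge0 //.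
  by rewrite mulr_ge0 ?nrm_ge0 // ltW.
apply/linear_boundedP; exists M%:C; split; first by rewrite ger0_real ?lecR.
move=> r Mr x; apply: (@le_trans _ _ (M%:C * `|x|)).
  rewrite !norm_nrm -rmorphM lecR.
  have := hM x; rewrite -!sqr_nrm -exprMn ler_sqr ?nnegrE ?nrm_ge0 //.
  by rewrite mulr_ge0 ?nrm_ge0.
by rewrite ler_wpM2r // ltW.
Qed.

Lemma tendsP (z : nat -> R[i]) l :
  tends z l <-> (fun n => z n : R[i]^o) @ \oo --> (l : R[i]^o).
Proof.
rewrite cvgrPdist_le; split=> [h e e0|h d d0].
  have eR : e = (complex.Re e)%:C by rewrite RRe_real // gtr0_real.
  move: e0; rewrite eR ltcR => /h[N hN]; exists N => // n /= /hN.
  by rewrite distrC normrE lecR.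
have /h[N _ hN] : 0 < d%:C by rewrite ltcR.
by exists N => n /hN /=; rewrite distrC normrE lecR.
Qed.

Lemma essential_numerical_rangeP (T : {linear H -> H}) l :
  essential_numerical_range ip T l <-> exists2 e : nat -> H,
    (forall i j, ip (e i) (e j) = (i == j)%:R) &
    tends (fun n => ip (T (e n)) (e n)) l.
Proof.
by split=> -[e he hl]; exists e => //; apply/tendsP.
Qed.

(** The failure of total boundedness; [d] measures squared distances. *)
Definition separated (d : R) (C : set H) := exists2 y : nat -> H,
  (forall n, C (y n)) & forall n m, (n < m)%N -> d <= N2 ip (y n - y m).

Lemma not_separated_cover (d : R) (C : set H) : ~ separated d C ->
  exists s : seq H, forall x, C x -> exists2 y, y \in s & N2 ip (y - x) < d.
Proof.
move=> nsep; apply: contrapT => nocov; apply: nsep.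
have next (s : seq H) : exists2 x, C x & forall y, y \in s -> d <= N2 ip (y - x).
  apply: contrapT => no; apply: nocov; exists s => x Cx; apply: contrapT => nx.
  apply: no; exists x => // y ys; rewrite leNgt; apply/negP => h; apply: nx.
  by exists y.
have [|||y hy] := @dependent_build _ (0 : H) (fun n y =>
    (forall i, (i < n)%N -> C (y i)) /\
    forall i j, (i < j)%N -> (j < n)%N -> d <= N2 ip (y i - y j)).
- move=> n f g E [h1 h2]; split=> [i ik|i j ij jn]; first by rewrite -E //; exact: h1.
  by rewrite -!E // ?h2 // (ltn_trans ij).
- by split.
- move=> n f [h1 h2]; have [x Cx hx] := next [seq f i | i <- iota 0 n].
  exists x; split=> [i|i j ij]; rewrite ltnS leq_eqVlt => /predU1P[E|ln].
  + by rewrite E eqxx.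
  + by rewrite (ltn_eqF ln); exact: h1.
  + rewrite -E eqxx (ltn_eqF ij); apply: hx; apply: map_f.
    by rewrite mem_iota -E.
  + by rewrite (ltn_eqF ln) (ltn_eqF (ltn_trans ij ln)); exact: h2.
exists y => [n|n m nm]; first by have [h _] := hy n.+1; exact: h.
by have [_ h] := hy m.+1; exact: h.
Qed.

(** By completeness it is enough that ultrafilters on the closure are Cauchy: one containing a
    finite union of balls contains one of the balls. *)
Lemma totally_bounded_precompact (C : set H) :
  (forall d, 0 < d -> ~ separated d C) -> precompact C.
Proof.
move=> hC; rewrite precompactE compact_ultra => F FU FC.
have /cauchy_cvg Fl : cauchy F; last first.
  exists (lim F); split=> //.
  by apply: (@closed_cvg _ _ F _ id (closure C)) => //; exact: closed_closure.
apply: cauchy_exP => e e0.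
have eR : e = (complex.Re e)%:C by rewrite RRe_real // gtr0_real.
move: e0; rewrite eR ltcR; set r := complex.Re e => r0.
have r2 : 0 < (r / 2) ^+ 2 by rewrite exprn_gt0 // divr_gt0.
have [s hs] := not_separated_cover (hC _ r2).
have {}hs : closure C `<=` [set x | exists2 y, y \in s & ball y r%:C x].
  move=> x Cx; have r20 : 0 < (r / 2)%:C by rewrite ltcR divr_gt0.
  have [x' [/hs[y ys yx'] xx']] := Cx _ (nbhsx_ballx x _ r20).
  exists y => //; have -> : r%:C = (r / 2)%:C + (r / 2)%:C.
    by rewrite -rmorphD /=; congr (_%:C); field.
  apply: (@ball_triangle _ _ x'); last exact: ball_sym.
  rewrite -ball_normE /= norm_nrm ltcR -(@ltr_pXn2r _ 2) ?nnegrE ?nrm_ge0 //.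
    by rewrite sqr_nrm.
  by rewrite ltW // divr_gt0.
move: hs => /filterS/(_ FC) {hC}; elim: s => [|y s IH] hs.
  by have [x [y]] := filter_ex hs.
have [Fy|Fy] := in_ultra_setVsetC (ball y r%:C) FU; first by exists y.
apply: IH; apply: filterS (filterI hs Fy) => x [[z]].
rewrite inE => /predU1P[-> //|zs zx _]; by exists z.
Qed.

End HilbertNorm.

(** * Spread of the essential numerical range *)

Section ValueSpread.
Variables (R : realType) (H : completeNormedModType R[i]).
Variable ip : {dot H for @Num.conj R[i]}.
Hypothesis hn : induces_norm ip.
Variables (T : {linear H -> H}) (M : R).
Hypothesis M0 : 0 <= M.
Hypothesis T_bounded : bounded_by ip M T.
Local Notation W := (essential_numerical_range ip T).

Definition affine_shift (c m : R[i]) (x : H) : H := c *: (T x - m *: x).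

Lemma affine_shift_linear c m : linear (affine_shift c m).
Proof.
move=> a x y; rewrite /affine_shift [T _]linearP (scalerDr m) (scalerA m) [m * a]mulrC.
by rewrite -(scalerA a) opprD addrACA -scalerBr scalerDr !scalerA [c * a]mulrC.
Qed.

HB.instance Definition _ c m := GRing.isLinear.Build R[i] H H *:%R
  (affine_shift c m) (affine_shift_linear c m).

Lemma affine_shift_bounded c m : exists2 K, 0 <= K & bounded_by ip K (affine_shift c m).
Proof.
have a0 : 0 <= modulus c * (M + modulus m).
  by rewrite mulr_ge0 ?addr_ge0 ?modulus_ge0.
exists (modulus c * (M + modulus m)) => // x.
have b0 := mulr_ge0 a0 (nrm_ge0 ip x).
rewrite -!sqr_nrm -exprMn ler_sqr ?nnegrE ?nrm_ge0 //.
rewrite /affine_shift nrmZ -mulrA ler_wpM2l ?modulus_ge0 // mulrDl.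
apply: (le_trans (nrmD _ _ _)); rewrite nrmN nrmZ lerD2r.
have := T_bounded x; rewrite -!sqr_nrm -exprMn ler_sqr ?nnegrE ?nrm_ge0 //.
by rewrite mulr_ge0 ?nrm_ge0.
Qed.

Lemma ip_affine_shift c m x : ip x x = 1 ->
  ip (affine_shift c m x) x = c * (ip (T x) x - m).
Proof. by move=> x1; rewrite /affine_shift ipZl ipBl ipZl x1 mulr1. Qed.

(** Otherwise [T - lam] has no nonzero essential value, so by [separated_value] the image of the
    unit ball contains no separated sequence and [T - lam] is compact. *)
Lemma another_value lam : ~ scalar_plus_compact T -> exists2 mu, W mu & mu <> lam.
Proof.
move=> nT; apply: contrapT => no; apply: nT.
pose K : {linear H -> H} := affine_shift 1 lam.
have [N N0 hN] := affine_shift_bounded 1 lam.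
exists lam, K; split; last by move=> x; rewrite /K /= /affine_shift scale1r addrC subrK.
  by apply/(bounded_operatorP hn); exists N.
apply: (totally_bounded_precompact hn) => d d0 [y Cy sep].
have hx n : exists x, N2 ip x <= 1 /\ K x = y n.
  have [x /= x1 <-] := Cy n; exists x; split=> //.
  move: x1; rewrite (norm_nrm hn) -[1]/(1%:C) lecR -sqr_nrm => x1.
  by rewrite expr_le1 // nrm_ge0.
have [x {}hx] := choice hx.
have [n|n m nm|e [l [he hl l0]]] := @separated_value _ _ ip K N hN N0 x d d0.
- by case: (hx n).
- by have [_ ->] := hx n; have [_ ->] := hx m; exact: sep.
apply: no; exists (l + lam); last first.
  by move=> h; apply: l0; apply: (addIr lam); rewrite h add0r.
apply/(essential_numerical_rangeP ip); exists e => //.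
have := tendsD hl (tends_cst lam); congr tends; apply/funext => n.
by rewrite /K ip_affine_shift ?he ?eqxx // mul1r subrK.
Qed.

Lemma essential_value_le l : W l -> modulus l <= M + 1.
Proof.
move=> /(essential_numerical_rangeP ip)[e he /(_ 1 ltr01)[N /(_ N (leqnn N))]].
set z := ip _ _ => h; rewrite -[l](subrK z) addrC.
apply: (le_trans (le_normcD _ _)); apply: lerD; last by rewrite -normcN opprB.
rewrite /z modulus_le //; apply: (le_trans (cauchy_schwarz _ _ _)).
have N1 : N2 ip (e N) = 1 by rewrite /N2 he eqxx.
by have := T_bounded (e N); rewrite N1 !mulr1.
Qed.

(** Two uses of [another_value] give two distinct values. So the diameter is positive, and some pair
    exceeds half of it. *)
Lemma diameter_attained : ~ scalar_plus_compact T -> 0 < diameter W /\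
  exists lam mu, [/\ W lam, W mu & diameter W / 2 < modulus (lam - mu)].
Proof.
move=> nT; have [a Wa _] := another_value 0 nT; have [b Wb ab] := another_value a nT.
set E := [set r | exists z w, [/\ W z, W w & r = modulus (z - w)]].
have Eab : E (modulus (a - b)) by exists a, b.
have Eub : has_ubound E.
  exists ((M + 1) + (M + 1)) => _ [z [w [Wz Ww ->]]].
  apply: (le_trans (le_normcD _ _)); rewrite normcN.
  by apply: lerD; exact: essential_value_le.
have D0 : 0 < diameter W.
  apply: lt_le_trans (ub_le_sup Eub Eab); rewrite lt_neqAle modulus_ge0 andbT eq_sym.
  by apply/eqP => /eq0_normc /subr0_eq E'; apply: ab.
split=> //; have D2 : 0 < diameter W / 2 by rewrite divr_gt0.
have [|_ [lam [mu [Wl Wm ->]]] h] := sup_adherent D2 (E := E).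
  by split=> //; exists (modulus (a - b)).
by exists lam, mu; split=> //; move: h; rewrite -/(diameter W); lra.
Qed.

End ValueSpread.

(** * Completeness of the sequence, and conclusion *)

Lemma geometric_drop (R : realType) (f : nat -> R) (th : R) :
  0 <= th < 1 -> (forall k, 0 <= f k) -> (forall k, f k.+1 <= f k) ->
  (forall m, exists2 k, (m <= k)%N & f k.+1 <= th * f k) ->
  forall e, 0 < e -> exists k, f k <= e.
Proof.
move=> /andP[th0 th1] f0 fS drop e e0; apply: contrapT => no.
have fe k : e <= f k by rewrite leNgt; apply/negP => /ltW h; apply: no; exists k.
have mono m k : (m <= k)%N -> f k <= f m.
  move=> /subnKC <-; elim: (k - m)%N => [|i IH]; first by rewrite addn0.
  by rewrite addnS; exact: le_trans (fS _) IH.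
have hE : has_inf (range f).
  by split; [exists (f 0%N); exists 0%N | exists 0 => _ [k _ <-]].
have L0 : e <= inf (range f) by apply: lb_le_inf; [case: hE | move=> _ [k _ <-]].
set L := inf _ in L0.
have d0 : 0 < L * (1 - th) by rewrite mulr_gt0 ?subr_gt0 // (lt_le_trans e0).
(* With a positive infimum [L], a drop from below [L * (2 - th)] would lead below [L], since
   [th * (2 - th) < 1]. *)
have [_ [m _ <-]] := inf_adherent d0 hE; rewrite -/L => fm.
have [k mk hk] := drop m.
have Lk : L <= f k.+1 by apply: ge_inf; [case: hE | exists k.+1].
have := ler_wpM2l th0 (mono _ _ mk).
have := ler_wpM2l th0 (ltW fm).
have : 0 < L * (1 - th) * (1 - th) by rewrite mulr_gt0 ?subr_gt0.
nra.
Qed.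

Lemma countable_sequence (T : choiceType) (t0 : T) (D : set T) : countable D ->
  exists y : nat -> T, forall x, D x -> exists n, y n = x.
Proof.
move=> /countable_injP[f finj].
exists (fun n => xget t0 [set x | D x /\ f x = n]) => x Dx; exists (f x).
case: xgetP => [z _ [Dz fz]|/(_ x)]; last by case.
by apply: finj; rewrite ?inE.
Qed.

Lemma esum_partial_sum (R : realType) (P : set nat) (f : nat -> R) (d : R) m n :
  (forall i, 0 <= f i) -> (\esum_(i in P) (f i)%:E <= d%:E)%E ->
  \sum_(m <= i < n) (if `[<P i>] then f i else 0) <= d.
Proof.
move=> f0 h; rewrite -lee_fin; apply: le_trans h; apply: esum_ge.
pose r := [seq i <- index_iota m n | `[<P i>]].
exists [set` r].
  split; first exact: finite_seq.
  by move=> i /=; rewrite mem_filter => /andP[/asboolP].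
rewrite -fsbig_seq ?filter_uniq ?iota_uniq // big_filter.
by rewrite sumEFin lee_fin -big_mkcond.
Qed.

Section Density.
Variables (R : realType) (H : completeNormedModType R[i]).
Variable ip : {dot H for @Num.conj R[i]}.
Hypothesis hn : induces_norm ip.

Lemma dense_linear_span (u : nat -> H) (y : nat -> H) (D : set H) :
  (forall i j, ip (u i) (u j) = (i == j)%:R) -> dense D ->
  (forall x, D x -> exists t, y t = x) ->
  (forall t e, 0 < e -> exists n,
    N2 ip (y t) - \sum_(0 <= l < n) sqm (ip (y t) (u l)) <= e) ->
  dense (linear_span u).
Proof.
move=> hu dD hy hd O O0 oO; have [z [Oz /hy[t yz]]] := dD O O0 oO.
rewrite -yz in Oz.
have /nbhs_ballP[e /= e0 he] : nbhs (y t) O by apply: open_nbhs_nbhs.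
have eR : e = (complex.Re e)%:C by rewrite RRe_real // gtr0_real.
move: e0 he; rewrite eR ltcR; set r := complex.Re e => r0 he.
have r2 : 0 < (r / 2) ^+ 2 by rewrite exprn_gt0 // divr_gt0.
have [n hn'] := hd t _ r2.
exists (\sum_(0 <= l < n) ip (y t) (u l) *: u l); split; last first.
  by exists n, (fun l => ip (y t) (u l)); rewrite big_mkord.
apply: he; rewrite -ball_normE /= (norm_nrm hn) ltcR.
rewrite -(@ltr_pXn2r _ 2) ?nnegrE ?nrm_ge0 ?(ltW r0) // sqr_nrm.
rewrite N2_proj ?iota_uniq //; apply: (le_lt_trans hn').
by rewrite ltr_pXn2r ?nnegrE ?divr_ge0 ?(ltW r0) //; lra.
Qed.

End Density.

Theorem theorem1p4 (R : realType) :
  exists delta : R -> R,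
    forall (H : completeNormedModType R[i]) (ip : {dot H for @Num.conj R[i]}),
      induces_norm ip -> separable_space H -> infinite_dimensional H ->
    forall T : {linear H -> H},
      bounded_operator T -> ~ scalar_plus_compact T ->
      let d := delta (diameter (essential_numerical_range ip T)) in
      0 < d /\
      forall (B : set (nat * nat)) (a : nat -> nat -> R[i]),
        subdiagonal B -> admissible B ->
        (forall j, (\esum_(n in [set n | B (n, j)]) (modulus (a n j))%:E
                    <= d%:E)%E) ->
        (forall n, (\esum_(j in [set j | B (n, j)]) (modulus (a n j))%:E
                    <= d%:E)%E) ->
        exists2 u : nat -> H, orthonormal_basis ip u &
          forall n j, B (n, j) -> ip (T (u j)) (u n) = a n j.
Proof.
(* As [modulus (lam - mu)] exceeds half of the diameter, the scaling factor has modulus less than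
   [4] over the diameter; so [400] yields the bound [1 / 100] on the scaled sums. *)
exists (fun r => r / 400) => H ip hn [D cD dD] _ T bT nT d.
have [M M0 T_bounded] := (bounded_operatorP hn T).1 bT.
have [D0 [lam [mu [Wl Wm lm]]]] := diameter_attained hn M0 T_bounded nT.
split=> [|B a subB [_ admB] colB rowB]; first by rewrite (divr_gt0 D0) ?ltr0n.
pose c := 2%:R / (lam - mu); pose m := (lam + mu) / 2%:R.
have lm0 : lam - mu != 0.
  apply/eqP => E; move: lm; rewrite E normc0 ltNge divr_ge0 //; exact: ltW.
have c0 : c != 0 by rewrite mulf_neq0 ?invr_eq0 // pnatr_eq0.
have cd : modulus c * d <= 100^-1.
  rewrite /c normcM normcV modulus_nat /d.
  set D' := diameter _ in lm D0 *; set l := modulus _ in lm *.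
  have l0 : 0 < l by apply: lt_trans lm; rewrite divr_gt0.
  rewrite mulrAC ler_pdivrMr //; lra.
pose S : {linear H -> H} := affine_shift T c m.
have [N N0 S_bounded] := affine_shift_bounded M0 T_bounded c m.
pose lim b := if b then lam else mu.
have fresh : fresh_vectors ip S.
  have hw b : exists e : nat -> H, (forall i j, ip (e i) (e j) = (i == j)%:R) /\
      tends (fun n => ip (T (e n)) (e n)) (lim b).
    by case: b; [move: Wl|move: Wm] => /(essential_numerical_rangeP ip)[e]; exists e.
  have [e he] := choice hw.
  apply: (fresh_from_witnesses S_bounded (e := e)) => b; have [e1 e2] := he b => //.
  have := tendsZ c (tendsB e2 (tends_cst m)).
  have -> : c * (lim b - m) = sgn R b.
    by rewrite /c /m /lim; case: b {e1 e2}; rewrite /sgn /=; field.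
  by congr tends; apply/funext => n; rewrite /S ip_affine_shift // e1 eqxx.
pose A n j := if `[<B (n, j)>] then c * a n j else 0.
have modA n j : modulus (A n j) = modulus c * (if `[<B (n, j)>] then modulus (a n j) else 0).
  by rewrite /A; case: ifP; rewrite ?normcM // normc0 mulr0.
have col_sum j p n : \sum_(p <= k < n) modulus (A k j) <= 100^-1.
  rewrite (eq_bigr _ (fun k _ => modA k j)) -mulr_sumr; apply: le_trans cd.
  rewrite ler_wpM2l ?modulus_ge0 //.
  exact: (esum_partial_sum p n (fun k => modulus_ge0 (a k j)) (colB j)).
have row_sum n p : \sum_(p <= j < n) modulus (A n j) <= 100^-1.
  rewrite (eq_bigr _ (fun j _ => modA n j)) -mulr_sumr; apply: le_trans cd.
  rewrite ler_wpM2l ?modulus_ge0 //.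
  exact: (esum_partial_sum p n (fun j => modulus_ge0 (a n j)) (rowB n)).
have adm p : exists2 n, (p < n)%N & forall j, (j <= p)%N -> ~ B (n, j).
  by have [n pn h] := admB p; exists n => // j /h[].
have [y hy] := countable_sequence (0 : H) cD.
have [base [rho [q [e [eps [tgt]]]]]] := schedule N0 col_sum adm.
set s := (1000 * _)^-1 => -[[base0 baseS rho0 qb] [rn rt] [rs rw] [cs eb e_b ee] inf_tgt].
have [u [hu SuA drop]] := basis_construction y N0 S_bounded fresh row_sum (fun j => col_sum j j.+1)
  base0 baseS rho0 qb rn rt rs rw cs eb e_b ee.
have s01 : 0 <= 1 - s ^+ 2 < 1.
  have s0 : 0 < s by rewrite invr_gt0 mulr_gt0 ?ltr0n ?ltr_wpDl.
  have s1 : s <= 1.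
    by rewrite invf_le1 ?mulr_gt0 ?ltr0n ?ltr_wpDl //; lra.
  rewrite subr_ge0 expr_le1 ?(ltW s0) // s1 gtrDl oppr_lt0 exprn_gt0 //.
exists u.
  split=> //; apply: (dense_linear_span hn hu dD hy) => t.
  apply: (geometric_drop s01) => [k|k|p].
  - by rewrite subr_ge0; apply: bessel; rewrite ?iota_uniq.
  - by rewrite big_nat_recr //= lerD2l lerN2 lerDl; exact: sqm_ge0.
  - by have [k pk /drop h] := inf_tgt t p; exists k.
(* Since [j < n], the shift by [m] drops out and the entries of [S] and [T] differ by the factor
   [c]. *)
move=> n j Bnj; have jn := subB _ Bnj; rewrite /= in jn.
have := SuA n j jn Bnj; rewrite /A asboolT // /S /= /affine_shift ipZl ipBl ipZl hu.
by rewrite (ltn_eqF jn) mulr0 subr0 => /(mulfI c0).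
Qed.
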